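(* Let $\mathbb{K}$ be a field, let $S=\mathbb{K}[x_1,\ldots,x_n]$, let $I\subset S$ be a nonzero proper homogeneous ideal, and let $v_1,\ldots,v_r$ be the set of Rees valuations of $I$. Then $$\rho_a(I)=\max_{i}\left\{\frac{v_i(I)}{\widehat{v}_i(I)}\right\}=\sup_{v}\left\{\frac{v(I)}{\widehat{v}(I)}\right\},$$ where the maximum is taken over the Rees valuations $v_i$ of $I$ and the supremum over all discrete valuations $v$ on $S$, in both cases over valuations supported on $I$.
   Context: Symbolic powers: for an ideal $I\subset S$ and $s\ge 1$, $I^{(s)}=\bigcap_{P\in\mathrm{Ass}(I)}(I^sS_P\cap S)$. Asymptotic resurgence: $\rho_a(I)=\sup\{\frac{s}{r}: s,r \text{ positive integers},\ I^{(st)}\not\subset I^{rt}\text{ for all } t\gg 0\}$. Let $\mathbf{K}$ be the fraction field of $S$. A discrete valuation on $S$ is a group homomorphism $v:\mathbf{K}^*\to\mathbb{Z}$ with $v(x+y)\ge\min\{v(x),v(y)\}$ whenever $x+y\ne 0$, and with $v(f)\ge 0$ for all nonzero $f\in S$. For a nonzero ideal $I$, $v(I)=\min\{v(f):0\neq f\in I\}$. The valuation $v$ is supported on $I$ if $v(I)\ge 1$. The skew Waldschmidt constant of $I$ with respect to $v$ is $\widehat{v}(I)=\lim_{s\to\infty}\frac{v(I^{(s)})}{s}$ (the limit exists by subadditivity, and it is positive when $v$ is supported on $I$). The Rees valuation rings of a nonzero ideal $I$ are the unique minimal finite set of discrete valuation rings $V_1,\ldots,V_r\subset\mathbf{K}$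 containing $S$, with fraction field $\mathbf{K}$, such that $\overline{I^m}=\bigcap_{i=1}^r (I^mV_i\cap S)$ for all $m\in\mathbb{N}$, where $\overline{J}$ denotes the integral closure of the ideal $J$. The corresponding valuations $v_1,\ldots,v_r$ (unique up to scaling) are the Rees valuations of $I$. *)

(* Defs.v *)
From mathcomp Require Import all_boot all_order all_algebra.
From mathcomp Require Import all_classical all_reals all_analysis.
(* The notations of mpoly are incompatible with those of mathcomp-analysis. *)
From mathcomp Require Import -(notations) mpoly.

Set Implicit Arguments.
Unset Strict Implicit.
Unset Printing Implicit Defensive.

Import Order.TTheory GRing.Theory Num.Theory.
Import numFieldNormedType.Exports.

Local Open Scope classical_set_scope.
Local Open Scope ring_scope.

Notation "{ 'mpoly' T [ n ] }" := (mpoly n T) : type_scope.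

Section Ideals.
Variable D : idomainType.
Implicit Types (I J P : set D).

(* Finite sums of products, so that it gives both the product of two ideals
   and the extension I V of an ideal I to an overring V. *)
Definition sumprod (T : comNzRingType) (A B : set T) : set T :=
  [set f | exists k (a b : 'I_k -> T),
    (forall i, A (a i) /\ B (b i)) /\ f = \sum_(i < k) a i * b i].

Definition ideal_pow I (s : nat) : set D := iter s (sumprod I) setT.

(* I V `&` D, for V a subring of the fraction field containing D. *)
Definition ext_contr I (V : set {fraction D}) : set D :=
  (@tofrac D) @^-1` sumprod V ((@tofrac D) @` I).

Definition prime_ideal P : Prop :=
  idealr_closed (mem P) /\ prime_idealr_closed (mem P).

(* Ass(I) is the set of associated primes of the module D / I, i.e. of the
   prime ideals of the form I : f. *)
Definition Ass I : set (set D) :=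
  [set P | prime_ideal P /\ exists f : D, P = [set g | I (g * f)]].

Definition localization P : set {fraction D} :=
  [set z | exists a g : D, ~ P g /\ z = tofrac a / tofrac g].

Definition symbolic_pow I (s : nat) : set D :=
  \bigcap_(P in Ass I) ext_contr (ideal_pow I s) (localization P).

Definition integral_closure J : set D :=
  [set f | exists (k : nat) (a : nat -> D),
    [/\ (0 < k)%N,
        forall i, (1 <= i <= k)%N -> ideal_pow J i (a i)
      & f ^+ k + \sum_(1 <= i < k.+1) a i * f ^+ (k - i) = 0]].

Definition asymptotic_resurgence (R : realType) I : \bar R :=
  ereal_sup [set x | exists s r : nat, [/\ (0 < s)%N, (0 < r)%N,
    \forall t \near \oo,
      ~ (symbolic_pow I (s * t) `<=` ideal_pow I (r * t))
    & x = (s%:R / r%:R)%:E]].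

End Ideals.

Section Valuations.
Variable D : idomainType.
Implicit Types (I : set D) (v : {fraction D} -> int).

(* A valuation is only meaningful on nonzero elements: v 0 is unspecified and
   never used below. *)
Definition discrete_valuation v : Prop :=
  [/\ forall x y, x != 0 -> y != 0 -> v (x * y) = v x + v y,
      forall x y, x != 0 -> y != 0 -> x + y != 0 ->
        Num.min (v x) (v y) <= v (x + y)
    & forall f : D, f != 0 -> 0 <= v (tofrac f)].

(* The minimum of v on I; it exists when I contains a nonzero element and v is
   a discrete valuation. *)
Definition val_ideal v I : int :=
  let values := [set v (tofrac f) | f in [set f | I f /\ f != 0]] in
  xget 0 (values `&` lbound values).

Definition supported v I : Prop := 1 <= val_ideal v I.

Definition skew_waldschmidt (R : realType) v I : R :=
  limn (fun s : nat => (val_ideal v (symbolic_pow I s))%:~R / s%:R : R).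

Definition valuation_ring v : set {fraction D} :=
  [set x | x = 0 \/ 0 <= v x].

(* The valuation rings of the nontrivial discrete valuations are exactly the
   discrete valuation rings contained in the fraction field of D, containing D
   and having the same fraction field as D. *)
Definition nontrivial v : Prop := exists2 x, x != 0 & v x != 0.

Definition represents_closures I r (v : 'I_r -> {fraction D} -> int)
    (A : set 'I_r) : Prop :=
  forall m : nat, integral_closure (ideal_pow I m) =
    \bigcap_(i in A) ext_contr (ideal_pow I m) (valuation_ring (v i)).

(* By minimality the rings valuation_ring (v i) are pairwise distinct. Each v i
   is determined by its ring up to scaling; no normalization is imposed. *)
Definition rees_valuations I r (v : 'I_r -> {fraction D} -> int) : Prop :=
  [/\ forall i, discrete_valuation (v i) /\ nontrivial (v i),
      represents_closures I v setT
    & forall A : set 'I_r, represents_closures I v A -> A = setT].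

End Valuations.

(* I contains the homogeneous components of its elements. *)
Definition homogeneous (K : fieldType) (n : nat) (I : set {mpoly K[n]}) : Prop :=
  forall f, I f -> forall d, I (pihomog mdeg d f).

(* Main.v *)
(* Write a_s for the least value of a valuation w on the symbolic power I^(s).
   The sequence a_s is subadditive, so a_s / s tends to its infimum, the skew
   Waldschmidt constant of w. If s times this constant is less than r w(I), then
   a_(st) < r t w(I) for large t, so I^(st) is not contained in I^(rt): this
   bounds the asymptotic resurgence from below for every w supported on I.
   Conversely, if the strict reverse inequality holds for every Rees valuation,
   then for large t the elements of I^(st) have enough value to be integral over
   I^(rt+mu), and the upper bound follows from two uniform containments for an
   ideal I with mu generators:
     - the integral closure of I^(N+mu) is contained in I^N,
     - the symbolic power of exponent (1+mu)N is contained in I^N,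
   the second one making the skew Waldschmidt constants positive.
   Over a perfect field of characteristic p both are tight closure arguments:
   c f^q belongs to the q-th Frobenius power of J = I^N for some c <> 0 and some
   q = p^e exceeding the degree of c, hence f is in J because the polynomial ring
   is free over its q-th powers. Over any field, a counterexample would be
   witnessed by finitely many coefficients, since J is homogeneous and f can be
   separated from it by a functional with finite support; it would then
   specialize to an algebraically closed field of positive characteristic. *)
Require Import Defs.
From mathcomp Require Import all_boot all_order all_algebra all_field.
From mathcomp Require Import all_classical all_reals all_analysis.
From mathcomp Require Import -(notations) mpoly.
From mathcomp Require Import ring lra zify.

Set Implicit Arguments.
Unset Strict Implicit.
Unset Printing Implicit Defensive.

Import Order.TTheory GRing.Theory Num.Theory.
Import numFieldNormedType.Exports.
Local Open Scope classical_set_scope.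
Local Open Scope ring_scope.

Local Notation "''X_[' m ]" := (@mpolyX _ _ m) (at level 8).
Local Notation "p @_ m" := (mcoeff m p) (at level 3, m at level 2).

(** * Ideals, their powers and finite generation *)

Section Ideals.
Variable T : comNzRingType.
Implicit Types (A B Q X : set T).

(* Unlike [idealr_closed], this allows the unit ideal. *)
Definition is_ideal A :=
  [/\ A 0, forall x y, A x -> A y -> A (x + y) & forall r x, A x -> A (r * x)].

Lemma is_ideal_sum A (J : Type) (s : seq J) (P : pred J) (F : J -> T) :
  is_ideal A -> (forall j, P j -> A (F j)) -> A (\sum_(j <- s | P j) F j).
Proof. by move=> [A0 AD _] AF; apply: (big_ind A). Qed.

Lemma is_idealN A x : is_ideal A -> A x -> A (- x).
Proof. by case=> _ _ AM Ax; rewrite -mulN1r; apply: AM. Qed.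

Lemma is_idealB A x y : is_ideal A -> A x -> A y -> A (x - y).
Proof. by move=> iA Ax Ay; case: (iA) => _ AD _; apply: AD => //; apply: is_idealN. Qed.

Lemma sumprod_sub A B Q : Q 0 -> (forall x y, Q x -> Q y -> Q (x + y)) ->
  (forall a b, A a -> B b -> Q (a * b)) -> sumprod A B `<=` Q.
Proof.
move=> Q0 QD QM _ [k [a [b [ab ->]]]].
by apply: (big_ind Q) => // i _; have [] := ab i; apply: QM.
Qed.

Lemma sumprod_mem A B a b : A a -> B b -> sumprod A B (a * b).
Proof.
by move=> Aa Bb; exists 1%N, (fun=> a), (fun=> b); rewrite big_ord1.
Qed.

Lemma sumprod0 A B : sumprod A B 0.
Proof.
by exists 0%N, (fun=> 0), (fun=> 0); rewrite big_ord0; split=> // -[].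
Qed.

Lemma sumprodD A B x y : sumprod A B x -> sumprod A B y -> sumprod A B (x + y).
Proof.
move=> [k [a [b [ab ->]]]] [l [c [d [cd ->]]]]; exists (k + l)%N.
exists (fun i => match fintype.split i with inl j => a j | inr j => c j end).
exists (fun i => match fintype.split i with inl j => b j | inr j => d j end).
split=> [i|]; first by case: (fintype.split i).
rewrite big_split_ord /=; congr (_ + _); apply: eq_bigr => i _.
  by rewrite -[lshift l i]/(fintype.unsplit (inl i)) unsplitK.
by rewrite -[rshift k i]/(fintype.unsplit (inr i)) unsplitK.
Qed.

Lemma sumprod_ideal A B : (forall r a, A a -> A (r * a)) ->
  is_ideal (sumprod A B).
Proof.
move=> AM; split; [exact: sumprod0|exact: sumprodD|] => r x.
move: x; apply: sumprod_sub => [|x y IHx IHy|a b Aa Bb].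
- by rewrite mulr0; apply: sumprod0.
- by rewrite mulrDr; apply: sumprodD.
- by rewrite mulrA; apply: sumprod_mem => //; apply: AM.
Qed.

Definition ideal_span X := sumprod setT X.

Lemma ideal_span_ideal X : is_ideal (ideal_span X).
Proof. exact: sumprod_ideal. Qed.

Lemma ideal_span_mem X x : X x -> ideal_span X x.
Proof. by move=> Xx; rewrite -[x]mul1r; apply: sumprod_mem. Qed.

Lemma ideal_span_sub X A : is_ideal A -> X `<=` A -> ideal_span X `<=` A.
Proof.
by case=> A0 AD AM XA; apply: sumprod_sub => // a b _ /XA; apply: AM.
Qed.

(** Only finitely many coefficients occur, so that a membership can later be specialized. Positions
    are used because [J] need not have decidable equality. *)
Lemma ideal_span_seqP (J : Type) (P : set J) (F : J -> T) x :
  ideal_span (F @` P) x ->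
  exists s : seq (T * J), (forall i, (i < size s)%N -> forall z0, P (nth z0 s i).2)
    /\ x = \sum_(z <- s) z.1 * F z.2.
Proof.
move: x; apply: sumprod_sub => [|x y [s [Ps ->]] [t [Pt ->]]|a _ _ [j Pj <-]].
- by exists [::]; rewrite big_nil.
- exists (s ++ t); rewrite big_cat; split=> // i; rewrite size_cat.
  move=> ist z0; rewrite nth_cat; case: ltnP => [/Ps//|si]; apply: Pt.
  by rewrite ltn_subLR.
- by exists [:: (a, j)]; rewrite big_seq1; split=> // -[].
Qed.

End Ideals.

Section GeneratorMonomials.
Variables (T : comNzRingType) (mu : nat) (g : 'I_mu -> T).

Definition gmon (c : 'I_mu -> nat) := \prod_i g i ^+ c i.

Definition gmons m := gmon @` [set c | \sum_i c i = m]%N.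

Lemma gmonM c d : gmon c * gmon d = gmon (fun i => c i + d i)%N.
Proof. by rewrite -big_split; apply: eq_bigr => i _; rewrite exprD. Qed.

End GeneratorMonomials.

Section IdealPowers.
Variable D : idomainType.
Implicit Types (I J : set D).

Lemma ideal_pow_ideal I s : is_ideal I -> is_ideal (ideal_pow I s).
Proof. by move=> iI; elim: s => // s _; apply: sumprod_ideal; case: iI. Qed.

Lemma ideal_powD I a b x y : is_ideal I ->
  ideal_pow I a x -> ideal_pow I b y -> ideal_pow I (a + b) (x * y).
Proof.
move=> iI Ix Iy; elim: a x Ix => [x _|a IH x].
  by have [_ _ +] := ideal_pow_ideal b iI; apply.
have [I0 ID _] := ideal_pow_ideal (a + b).+1 iI.
move: x; apply: sumprod_sub => [|x z|c d Ic Id].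
- by rewrite mul0r.
- by rewrite mulrDl; apply: ID.
- by rewrite -mulrA; apply: sumprod_mem => //; apply: IH.
Qed.

Lemma ideal_pow_exp I a k x : is_ideal I ->
  ideal_pow I a x -> ideal_pow I (a * k) (x ^+ k).
Proof.
move=> iI Ix; elim: k => [|k IH]; first by rewrite muln0.
by rewrite mulnS exprS; apply: ideal_powD.
Qed.

Lemma ideal_pow_pow I a b : is_ideal I ->
  ideal_pow (ideal_pow I a) b `<=` ideal_pow I (a * b).
Proof.
move=> iI; elim: b => [|b IH]; first by rewrite muln0.
have [I0 ID _] := ideal_pow_ideal (a * b.+1) iI.
apply: sumprod_sub => // x y Ix /IH Iy.
by rewrite mulnS; apply: ideal_powD.
Qed.

Lemma ideal_pow_anti I a b : is_ideal I -> (a <= b)%N ->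
  ideal_pow I b `<=` ideal_pow I a.
Proof.
move=> iI /subnK <-; elim: (b - a)%N => // k IH.
apply: subset_trans IH; have [I0 ID IM] := ideal_pow_ideal (k + a) iI.
by apply: sumprod_sub => // x y _; apply: IM.
Qed.

Lemma ideal_pow1 I : is_ideal I -> ideal_pow I 1 = I.
Proof.
move=> [I0 ID IM]; apply/seteqP; split.
  by apply: sumprod_sub => // a b Ia _; rewrite mulrC; apply: IM.
by move=> x Ix; rewrite -[x]mulr1; apply: sumprod_mem.
Qed.

Lemma ideal_pow1S I x s : is_ideal I -> I x -> ideal_pow I s (x ^+ s).
Proof.
move=> iI; rewrite -{1}(ideal_pow1 iI) => Ix.
by rewrite -{1}[s]mul1n; apply: ideal_pow_exp.
Qed.

Variables (mu : nat) (g : 'I_mu -> D).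
Local Notation gmon := (gmon g).
Local Notation gmons := (gmons g).

Lemma gmon_ideal_pow I c : is_ideal I -> (forall i, I (g i)) ->
  ideal_pow I (\sum_i c i) (gmon c).
Proof.
move=> iI Ig; rewrite /gmon.
elim/big_rec2 : _ => // i m x _ Ix.
by apply: ideal_powD => //; apply: ideal_pow1S.
Qed.

Lemma ideal_pow_gen m :
  ideal_pow (ideal_span (range g)) m = ideal_span (gmons m).
Proof.
apply/seteqP; split; last first.
  have iI := ideal_span_ideal (range g).
  apply: ideal_span_sub; first exact: ideal_pow_ideal.
  move=> _ [c <- <-]; apply: gmon_ideal_pow => // i.
  by apply: ideal_span_mem; exists i.
elim: m => [x _|m IH].
  rewrite -[x]mulr1; apply: sumprod_mem => //; exists (fun=> 0)%N; rewrite ?/gmon.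
    by rewrite /= big1.
  by rewrite big1.
have [J0 JD JM] := ideal_span_ideal (gmons m.+1).
apply: sumprod_sub => // a b Ia /IH Ib; move: a Ia b Ib.
apply: sumprod_sub => [b _|x y Hx Hy b Ib|a _ _ [i _ <-]].
- by rewrite mul0r.
- by rewrite mulrDl; apply: JD; [apply: Hx|apply: Hy].
apply: sumprod_sub => [|x y|b _ _ [c cm <-]].
- by rewrite mulr0.
- by rewrite mulrDr; apply: JD.
rewrite mulrACA; apply: sumprod_mem => //.
exists (fun j => (i == j) + c j)%N => /=.
  by rewrite big_split /= cm (bigD1 i) //= eqxx big1 // => j; rewrite eq_sym => /negPf->.
rewrite -gmonM; congr (_ * _).
by rewrite /gmon (bigD1 i) //= eqxx big1 ?mulr1 // => j; rewrite eq_sym => /negPf->.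
Qed.

End IdealPowers.

(** * Dickson's lemma and the Hilbert basis theorem *)

Section Noetherian.

Lemma nondecreasing_subsequence (u : nat -> nat) :
  exists2 s : nat -> nat, {homo s : i j / (i < j)%N} &
    {homo u \o s : i j / (i <= j)%N}.
Proof.
(* [h m] is an index from [m] on at which [u] is least; [s] iterates it past the previous index. *)
have /choice[h hP] : forall m, exists i, (m <= i)%N /\
    forall j, (m <= j)%N -> (u i <= u j)%N.
  move=> m; have : exists k, `[< exists2 i, (m <= i)%N & u i = k >].
    by exists (u m); apply/asboolP; exists m.
  move=> /ex_minnP[k /asboolP[i mi <-] kmin]; exists i; split=> // j mj.
  by apply: kmin; apply/asboolP; exists j.
pose s := fix s k := if k is k'.+1 then h (s k').+1 else h 0%N.
exists s; first by apply: homo_ltn => [|k]; [exact: ltn_trans|case: (hP (s k).+1)].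
apply: homo_leq => [//||k /=]; first exact: leq_trans.
case: k => [|k] /=; first by have [_] := hP 0%N; apply.
have [h1 +] := hP (s k).+1; apply; apply: leq_trans h1 _.
by have [/ltnW] := hP (h (s k).+1).+1.
Qed.

Lemma dickson n (f : nat -> multinom n) :
  exists i j, (i < j)%N /\ lem (f i) (f j).
Proof.
(* Each further extraction of a subsequence makes one more coordinate nondecreasing. *)
have /(_ n)[s sm sf] : forall k, exists2 s : nat -> nat,
    {homo s : i j / (i < j)%N} &
    forall c : 'I_n, (c < k)%N -> {homo (fun i => f (s i) c) : i j / (i <= j)%N}.
  elim=> [|k [s sm sf]]; first by exists id.
  have [kn|nk] := ltnP k n; last first.
    by exists s => // c _; apply/sf/(leq_trans (ltn_ord c)).
  have [t tm tf] := nondecreasing_subsequence (fun i => f (s i) (Ordinal kn)).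
  exists (s \o t) => [i j /tm/sm //|c].
  have tw : {homo t : i j / (i <= j)%N} by apply/ltnW_homo.
  rewrite ltnS leq_eqVlt => /orP[/eqP ck|ck] i j ij; last exact/sf/tw.
  by rewrite (_ : c = Ordinal kn); [apply: tf|apply: val_inj].
exists (s 0%N), (s 1%N); split; first exact: sm.
by apply/mnm_lepP => c; apply: sf.
Qed.

Variables (K : fieldType) (n : nat).
Implicit Types (I : set {mpoly K[n]}) (s : seq {mpoly K[n]}).

(** One division step: [h] is the quotient of the leading terms, so that these cancel. *)
Lemma ltm_mlead_div (f g : {mpoly K[n]}) : f != 0 -> g != 0 ->
  lem (mlead g) (mlead f) ->
  exists h, f - h * g = 0 \/ (mlead (f - h * g)%R < mlead f)%O.
Proof.
move=> f0 g0 gf.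
pose h := (f@_(mlead f) / g@_(mlead g)) *: 'X_[mnm_sub (mlead f) (mlead g)].
have fc : f@_(mlead f) != 0 by rewrite mleadc_eq0.
have gc : g@_(mlead g) != 0 by rewrite mleadc_eq0.
have c0 : f@_(mlead f) / g@_(mlead g) != 0 by rewrite mulf_neq0 ?invr_eq0.
have h0 : h != 0 by rewrite scaler_eq0 negb_or c0 -msupp_eq0 msuppX.
have hE : mlead h = mnm_sub (mlead f) (mlead g) by rewrite mleadZ ?mleadXm.
have hgE : mlead (h * g) = mlead f by rewrite mleadM // hE submK.
exists h; have [->|e0] := eqVneq (f - h * g) 0; [by left|right].
rewrite lt_neqAle; apply/andP; split; last first.
  by rewrite (le_trans (mleadB_le _ _)) // hgE joinxx.
apply: contraNneq e0 => e0; rewrite -mleadc_eq0 e0 mcoeffB.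
rewrite -[X in _ - (h * g)@_ X]hgE mleadM // mleadcM hE.
by rewrite mcoeffZ mcoeffX eqxx mulr1 divfK // subrr.
Qed.

(* If I is not finitely generated, choose f_0, f_1, ... in I, each outside the
   ideal of the previous ones and with the least possible leading monomial; by
   Dickson's lemma some f_j can then be reduced by an earlier f_i. *)
Lemma hilbert_basis I : is_ideal I -> exists s, I = ideal_span [set` s].
Proof.
move=> iI; apply: contrapT => nfg.
have /choice[pk pkP] : forall s, exists f, (forall x, x \in s -> I x) ->
   [/\ I f, ~ ideal_span [set` s] f &
     forall h, I h -> ~ ideal_span [set` s] h -> (mlead f <= mlead h)%O].
  move=> s; have [sI|sI] := pselect (forall x, x \in s -> I x); last by exists 0.
  have [f [If fs]] : exists f, I f /\ ~ ideal_span [set` s] f.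
    apply: contrapT => none; apply: nfg; exists s; apply/seteqP; split.
      by move=> f If; apply: contrapT => fs; apply: none; exists f.
    exact: ideal_span_sub.
  have [m mf] : exists m, m = mlead f by exists (mlead f).
  elim/(well_founded_ind (@ltom_wf n)): m f mf If fs => m IH f mf If fs.
  have [[h [Ih hs hf]]|none] := pselect (exists h,
      [/\ I h, ~ ideal_span [set` s] h & (mlead h < mlead f)%O]).
    by apply: (IH (mlead h) _ h) => //; rewrite mf.
  exists f => _; split=> // h Ih hs; rewrite leNgt; apply/negP => hf.
  by apply: none; exists h.
pose S := fix S k := if k is k'.+1 then rcons (S k') (pk (S k')) else [::].
pose f k := pk (S k).
have SI k x : x \in S k -> I x.
  elim: k x => //= k IH x; rewrite mem_rcons inE => /orP[/eqP->|/IH//].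
  by have [] := pkP _ IH.
have fS i j : (i < j)%N -> f i \in S j.
  elim: j => // j IH; rewrite ltnS leq_eqVlt mem_rcons inE.
  by move=> /orP[/eqP->|/IH->]; rewrite ?eqxx ?orbT.
have [i [j [ij lij]]] := dickson (fun k => mlead (f k)).
have [Ifj fjS fjmin] := pkP _ (SI j).
have [Ifi fiS _] := pkP _ (SI i).
have f0 k : f k != 0.
  apply/eqP => fk0; have [_ + _] := pkP _ (SI k); rewrite -/(f k) fk0; apply.
  exact: sumprod0.
have [h hP] := ltm_mlead_div (f0 j) (f0 i) lij.
have hS : ideal_span [set` S j] (h * f i).
  by apply: sumprod_mem => //; apply: fS.
have rS : ~ ideal_span [set` S j] (f j - h * f i).
  move=> rS; apply: fjS; rewrite -/(f j) -(subrK (h * f i) (f j)).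
  by apply: sumprodD.
case: hP => [r0|]; first by apply: rS; rewrite r0; apply: sumprod0.
rewrite ltNge => /negP; apply; apply: fjmin => //.
by apply: is_idealB => //; case: iI => _ _; apply.
Qed.

Lemma ideal_fg I : is_ideal I ->
  exists mu (g : 'I_mu -> {mpoly K[n]}), I = ideal_span (range g).
Proof.
move=> /hilbert_basis[s ->]; exists (size s), (fun i => nth 0 s i).
congr ideal_span; apply/seteqP; split=> x /=.
  by move=> xs; exists (Ordinal (etrans (index_mem x s) xs)) => //=; rewrite nth_index.
by move=> [i _ <-]; rewrite mem_nth.
Qed.

End Noetherian.

Lemma prime_idealN (D : idomainType) (P : set D) (x y : D) :
  prime_idealr_closed (mem P) -> ~ P x -> ~ P y -> ~ P (x * y).
Proof. by move=> Pp Px Py /mem_set/(Pp x y)/orP[] /set_mem. Qed.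

(** * Associated primes and symbolic powers *)

Section Associated.
Variable D : idomainType.
Hypothesis noeth : forall J : set D, is_ideal J -> exists s : seq D, J = ideal_span [set` s].
Variable I : set D.
Hypothesis iI : is_ideal I.

(** Otherwise choice gives a strictly ascending chain in the family; its union is finitely
    generated, hence contained in a term of the chain. *)
Lemma maximal_ideal_of (Fam : set (set D)) (J0 : set D) :
  (forall J, Fam J -> is_ideal J) -> Fam J0 ->
  exists2 J, Fam J & forall J', Fam J' -> J `<=` J' -> J' `<=` J.
Proof.
move=> Fi F0; apply: contrapT => nomax.
have /choice[nx nxP] : forall J, exists J', Fam J ->
    [/\ Fam J', J `<=` J' & ~ J' `<=` J].
  move=> J; have [FJ|] := pselect (Fam J); last by exists J0.
  apply: contrapT => none; apply: nomax; exists J => // J' FJ' JJ'.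
  by apply: contrapT => J'J; apply: none; exists J'.
pose S k := iter k nx J0.
have SF k : Fam (S k) by elim: k => //= k /nxP[].
have Sle : {homo S : i j / (i <= j)%N >-> i `<=` j}.
  apply: homo_leq => [x|y x z|k].
  - exact: subset_refl.
  - exact: subset_trans.
  -
  by have [] := nxP _ (SF k).
have iU : is_ideal (\bigcup_k S k).
  split=> [|x y [i _ Si] [j _ Sj]|r x [i _ Si]].
  - by exists 0%N => //; have [] := Fi _ F0.
  - exists (maxn i j) => //; have [_ SD _] := Fi _ (SF (maxn i j)); apply: SD.
      exact: Sle (leq_maxl i j) _ Si.
    exact: Sle (leq_maxr i j) _ Sj.
  - by exists i => //; have [_ _ SM] := Fi _ (SF i); apply: SM.
have [s Us] := noeth iU.
have [k sk] : exists k, [set` s] `<=` S k.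
  have : [set` s] `<=` \bigcup_k S k by rewrite Us => x; apply: ideal_span_mem.
  elim: s {Us} => [|x s IH] sU; first by exists 0%N.
  have [|k sk] := IH; first by move=> y ys; apply: sU; rewrite /= inE ys orbT.
  have [l _ xl] := sU x (mem_head x s).
  exists (maxn k l) => y /=; rewrite inE => /orP[/eqP->|ys].
    exact: Sle (leq_maxr k l) _ xl.
  by apply: Sle (leq_maxl k l) _ _; apply: sk.
have [_ _] := nxP _ (SF k); apply => x Sx.
apply: (ideal_span_sub (Fi _ (SF k)) sk); rewrite -Us.
by exists k.+1.
Qed.

Lemma colon_ideal f : is_ideal [set g | I (g * f)].
Proof.
have [I0 ID IM] := iI; split=> [|x y /= Ix Iy|r x /= Ix].
- by rewrite /= mul0r.
- by rewrite mulrDl; apply: ID.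
- by rewrite -mulrA; apply: IM.
Qed.

(* A maximal element among the ideals I : u h different from the unit ideal is
   prime. *)
Lemma exists_associated_prime h : ~ I h ->
  exists2 P, Ass I P & [set g | I (g * h)] `<=` P.
Proof.
move=> Ih.
have [I0 ID IM] := iI.
pose Fam := [set J | exists2 u, ~ I (u * h) & J = [set g | I (g * (u * h))]].
have [||P [u Iuh PE] Pmax] := @maximal_ideal_of Fam [set g | I (g * h)].
- by move=> _ [u _ ->]; apply: colon_ideal.
- by exists 1; rewrite mul1r.
exists P; last by move=> g /= gh; rewrite PE /= mulrCA; apply: IM.
have [P0 PD PM] := colon_ideal (u * h).
split; last by exists (u * h).
rewrite PE; split.
  split; [by rewrite inE|by apply/negP; rewrite inE /= mul1r|].
  by move=> a x y; rewrite !inE => Px Py; apply: PD => //; apply: PM.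
move=> a b; rewrite !inE /= => Iab.
have [Ia|Ia] := pselect (I (a * (u * h))); apply/orP; [left|right]; rewrite inE //.
(* As [a u h] is not in I, the ideal [I : a u h] is in the family; it contains [I : u h] and [b],
   and maximality applies. *)
have := Pmax [set g | I (g * (a * u * h))]; rewrite PE; apply.
- by exists (a * u) => //; rewrite -mulrA.
- by move=> g /= Ig; rewrite -(mulrA a) mulrCA; apply: IM.
- by rewrite /= -(mulrA a) mulrA (mulrC b).
Qed.

(** A finite sum of fractions has a common denominator, which stays outside the prime P; clearing it
    gives [g]. *)
Lemma symbolic_powP s f : symbolic_pow I s f <->
  forall P, Ass I P -> exists2 g, ~ P g & ideal_pow I s (g * f).
Proof.
have [J0 JD JM] := ideal_pow_ideal s iI.
split=> [If P AP|If P AP].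
  have [[[/[!inE] P0 /negP/[!inE] P1 _] Pp] _] := AP.
  have {}Pp := prime_idealN Pp.
  have nz g : ~ P g -> tofrac g != 0.
    by move=> Pg; apply: contra_not_neq Pg => /eqP; rewrite tofrac_eq0 => /eqP->.
  suff [g [b [Pg Jb fgb]]] : exists g b, [/\ ~ P g, ideal_pow I s b &
      tofrac f * tofrac g = tofrac b].
    by exists g => //; move/eqP: fgb; rewrite -rmorphM tofrac_eq mulrC => /eqP->.
  pose Q (z : {fraction D}) := exists g b,
    [/\ ~ P g, ideal_pow I s b & z * tofrac g = tofrac b].
  have : sumprod (localization P) (@tofrac D @` ideal_pow I s) (tofrac f).
    exact: If.
  move: (tofrac f); apply: (@sumprod_sub _ _ _ Q).
  - by exists 1, 0; rewrite mul0r rmorph0.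
  - move=> x y [g [b [Pg Jb xE]]] [g' [b' [Pg' Jb' yE]]].
    exists (g * g'), (b * g' + b' * g); split; first exact: Pp.
      by rewrite mulrC (mulrC b'); apply: JD; apply: JM.
    by rewrite rmorphD !rmorphM /= -xE -yE; ring.
  - move=> _ _ [a [g [Pg ->]]] [b Jb <-]; exists g, (a * b); split=> //.
      exact: JM.
    by rewrite rmorphM mulrAC divfK ?nz.
have [g Pg Ig] := If P AP.
have g0 : tofrac g != 0 :> {fraction D}.
  have [[[/[!inE] P0 _ _] _] _] := AP.
  by apply: contra_not_neq Pg => /eqP; rewrite tofrac_eq0 => /eqP->.
rewrite /ext_contr /= (_ : tofrac f = (tofrac 1 / tofrac g) * tofrac (g * f)); last first.
  by rewrite rmorph1 mul1r rmorphM mulKf.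
by apply: sumprod_mem; [exists 1, g|exists (g * f)].
Qed.

(** Otherwise [I : h] lies in an associated prime P, yet it contains the multiplier outside P given
    by [symbolic_powP]. The containment of symbolic powers uses associated primes only through this
    lemma. *)
Lemma symbolic_pow_colon s f h : symbolic_pow I s f ->
  (forall l, ideal_pow I s (l * f) -> I (l * h)) -> I h.
Proof.
move=> /symbolic_powP If lh; apply: contrapT => /exists_associated_prime[P AP hP].
by have [g Pg /lh /hP] := If P AP.
Qed.

Lemma sub_symbolic_pow s : ideal_pow I s `<=` symbolic_pow I s.
Proof.
move=> f If; apply/symbolic_powP => P [[[_ /negP/[!inE] P1 _] _] _].
by exists 1; rewrite ?mul1r.
Qed.

Lemma symbolic_powM s t f g : symbolic_pow I s f -> symbolic_pow I t g ->
  symbolic_pow I (s + t) (f * g).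
Proof.
move=> /symbolic_powP If /symbolic_powP Ig; apply/symbolic_powP => P AP.
have [x Px Ix] := If P AP; have [y Py Iy] := Ig P AP.
exists (x * y); last by rewrite mulrACA; apply: ideal_powD.
by have [[_ Pp] _] := AP; apply: (prime_idealN Pp).
Qed.

End Associated.

(** * Perfect fields of positive characteristic *)

Section CoefficientwiseExtension.
Variables (n : nat) (R : nzRingType) (V : nmodType).
Variable t : multinom n -> R -> V.

(** The additive map prescribed by its effect on each term; the Frobenius coordinates and the
    pairing [dot] are both of this form. *)
Definition mpoly_ext (u : {mpoly R[n]}) : V := \sum_(m <- msupp u) t m u@_m.

Hypothesis t0 : forall m, t m 0 = 0.
Hypothesis tD : forall m c d, t m (c + d) = t m c + t m d.

Lemma mpoly_extwE B (u : {mpoly R[n]}) : (mmeasure mdeg u <= B)%N ->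
  mpoly_ext u = \sum_(m : bmultinom n B) t m u@_m.
Proof.
move=> uB; rewrite /mpoly_ext (ssrcomplements.big_mksub (bmultinom n B)) ?msupp_uniq //=;
  last first.
  by move=> x /msize_mdeg_lt /leq_trans; apply.
by rewrite big_rmcond //= => j /memN_msupp_eq0 ->.
Qed.

Lemma mpoly_extD u w : mpoly_ext (u + w) = mpoly_ext u + mpoly_ext w.
Proof.
set s := @mmeasure n R mdeg.
rewrite !(@mpoly_extwE (maxn (s u) (s w))) ?leq_maxl ?leq_maxr ?msizeD_le //.
by rewrite -big_split; apply: eq_bigr => m _; rewrite mcoeffD tD.
Qed.

Lemma mpoly_ext0 : mpoly_ext 0 = 0.
Proof. by rewrite /mpoly_ext msupp0 big_nil. Qed.

Lemma mpoly_extX c m : mpoly_ext (c *: 'X_[m]) = t m c.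
Proof.
have [->|c0] := eqVneq c 0; first by rewrite scale0r mpoly_ext0 t0.
by rewrite /mpoly_ext msuppMCX // big_seq1 mcoeffZ mcoeffX eqxx mulr1.
Qed.

End CoefficientwiseExtension.

Section Frobenius.
Variables (F : closedFieldType) (p : nat) (charFp : p \in [pchar F]) (n : nat).
Local Notation S := {mpoly F[n]}.
Local Notation msize := (@mmeasure n F mdeg).
Variable e : nat.
Let q := (p ^ e)%N.

Let q_gt0 : (0 < q)%N.
Proof. by rewrite expn_gt0 prime_gt0 // (pcharf_prime charFp). Qed.

Lemma pchar_mpoly : p \in [pchar S].
Proof.
move: charFp; rewrite !inE => /andP[-> /eqP p0].
by rewrite -mpolyC_nat p0 mpolyC0 eqxx.
Qed.

Lemma exprDq (R : comNzRingType) (x y : R) : p \in [pchar R] ->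
  (x + y) ^+ q = x ^+ q + y ^+ q.
Proof.
move=> Rp; apply: exprDn_pchar; rewrite (eq_pnat _ (pcharf_eq Rp)) pnatX.
by rewrite pnat_id ?(pcharf_prime charFp).
Qed.

Lemma exists_rootq (c : F) : exists x, x ^+ q = c.
Proof.
have /closed_rootP[x] : size ('X^q - c%:P) != 1%N.
  by rewrite size_XnsubC // eqSS -lt0n.
by rewrite /root !hornerE subr_eq0 => /eqP <-; exists x.
Qed.

(** The inverse of the iterated Frobenius; [expq_inj] makes it additive. *)
Definition rootq c := sval (cid (exists_rootq c)).

Lemma rootqK c : rootq c ^+ q = c.
Proof. exact: svalP (cid (exists_rootq c)). Qed.

Lemma expq_inj : injective (fun x : F => x ^+ q).
Proof.
move=> x y /= /eqP; rewrite -{1}(subrK y x) exprDq // -subr_eq0 addrK.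
by rewrite expf_eq0 subr_eq0 => /andP[_ /eqP].
Qed.

Lemma rootq0 : rootq 0 = 0.
Proof. by apply: expq_inj; rewrite /= rootqK expr0n gtn_eqF. Qed.

Lemma rootqD c d : rootq (c + d) = rootq c + rootq d.
Proof. by apply: expq_inj; rewrite /= exprDq // !rootqK. Qed.

Lemma rootqM c d : rootq (c ^+ q * d) = c * rootq d.
Proof. by apply: expq_inj; rewrite /= exprMn !rootqK. Qed.

Local Notation digit := {ffun 'I_n -> 'I_q}.

Definition mnm_divq (m : multinom n) : multinom n :=
  Multinom [tuple (m i %/ q)%N | i < n].

Definition mnm_modq (m : multinom n) : digit :=
  [ffun i => Ordinal (ltn_pmod (m i) q_gt0)].

Definition digit_mnm (a : digit) : multinom n :=
  Multinom [tuple (a i : nat) | i < n].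

Lemma mnm_divq_modq m : mnm_add (digit_mnm (mnm_modq m)) (mnm_muln (mnm_divq m) q) = m.
Proof.
by apply/mnmP => i; rewrite mnmDE mulmnE !mnmE ffunE /= addnC -divn_eq.
Qed.

Lemma mnm_divqM m k : mnm_divq (mnm_add (mnm_muln m q) k) = mnm_add m (mnm_divq k).
Proof. by apply/mnmP => i; rewrite mnmDE !mnmE mulmnE divnMDl. Qed.

Lemma mnm_modqM m k : mnm_modq (mnm_add (mnm_muln m q) k) = mnm_modq k.
Proof. by apply/ffunP => i; rewrite !ffunE; apply: val_inj; rewrite /= mnmE mulmnE modnMDl. Qed.

Lemma mdeg_divq m : (mdeg (mnm_divq m) * q <= mdeg m)%N.
Proof.
by rewrite !mdegE big_distrl; apply: leq_sum => i _ /=; rewrite mnmE leq_divM.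
Qed.

(* The coordinates of the free S^q-module S, followed by the inverse of the
   Frobenius: u is the sum of the x^a (frob_coord a u)^q for 0 <= a_i < q. *)
Definition frob_term (a : digit) (m : multinom n) (c : F) : S :=
  if mnm_modq m == a then rootq c *: 'X_[mnm_divq m] else 0.

Definition frob_coord a : S -> S := mpoly_ext (frob_term a).

Lemma frob_term0 a m : frob_term a m 0 = 0.
Proof. by rewrite /frob_term rootq0 scale0r if_same. Qed.

Lemma frob_termD a m c d :
  frob_term a m (c + d) = frob_term a m c + frob_term a m d.
Proof. by rewrite /frob_term; case: ifP; rewrite ?addr0 // rootqD scalerDl. Qed.

Lemma frob_coordD a u w : frob_coord a (u + w) = frob_coord a u + frob_coord a w.
Proof. by apply: mpoly_extD; [exact: frob_term0|exact: frob_termD]. Qed.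

Lemma frob_coordX a c m : frob_coord a (c *: 'X_[m]) = frob_term a m c.
Proof. by apply: mpoly_extX; exact: frob_term0. Qed.

Lemma frob_coord0 a : frob_coord a 0 = 0.
Proof. exact: mpoly_ext0. Qed.

(** It suffices to compare terms: multiplication by a q-th power of a monomial keeps the exponents
    modulo q and only shifts their quotients. *)
Lemma frob_coordM a z u : frob_coord a (z ^+ q * u) = z * frob_coord a u.
Proof.
elim/mpolyind: z => [|c m z _ _ IHz].
  by rewrite expr0n gtn_eqF // !mul0r frob_coord0.
rewrite exprDq ?pchar_mpoly // !mulrDl frob_coordD IHz; congr (_ + _) => {z IHz}.
elim/mpolyind: u => [|d k u _ _ IHu]; first by rewrite !mulr0 frob_coord0 mulr0.
rewrite mulrDr !frob_coordD mulrDr IHu; congr (_ + _) => {u IHu}.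
rewrite exprZn mpolyXn -scalerAr -scalerAl scalerA -mpolyXD !frob_coordX.
rewrite /frob_term mnm_modqM mnm_divqM; case: ifP => _; last by rewrite mulr0.
by rewrite (mulrC d) rootqM mpolyXD -scalerAl -scalerAr scalerA.
Qed.

Lemma frob_coordK u : u = \sum_a 'X_[digit_mnm a] * frob_coord a u ^+ q.
Proof.
elim/mpolyind: u => [|c m u _ _ IHu].
  by rewrite big1 // => a _; rewrite frob_coord0 expr0n gtn_eqF // mulr0.
rewrite {1}IHu.
under [in RHS]eq_bigr => a _ do
  rewrite frob_coordD exprDq ?pchar_mpoly // mulrDr frob_coordX.
rewrite big_split /=; congr (_ + _); rewrite (bigD1 (mnm_modq m)) //=.
rewrite big1 => [|a /negPf am].
  rewrite addr0 /frob_term eqxx exprZn rootqK mpolyXn -scalerAr -mpolyXD.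
  by rewrite mnm_divq_modq.
by rewrite /frob_term eq_sym am expr0n gtn_eqF // mulr0.
Qed.

(** Degrees are divided by q, which forces the coordinates to be constant for large q. *)
Lemma mdeg_frob_coord a u m : m \in msupp (frob_coord a u) ->
  exists2 m', m' \in msupp u & (mdeg m * q <= mdeg m')%N.
Proof.
move=> /msupp_sum_le /flattenP[s /mapP[m' + ->]].
rewrite filter_predT => m'u; rewrite /frob_term; case: ifP => _; last first.
  by rewrite msupp0.
move=> /msuppZ_le /mem_msuppXP <-; exists m' => //.
exact: mdeg_divq.
Qed.

(** The Frobenius power J^[q]. *)
Definition frob_pow (J : set S) : set S := ideal_span ((fun h => h ^+ q) @` J).

(** S is free over S^q on the monomials with exponents below q, so membership is tested
    coordinatewise. *)
Lemma frob_powP (J : set S) u : is_ideal J ->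
  frob_pow J u <-> forall a, J (frob_coord a u).
Proof.
move=> iJ; have [J0 JD JM] := iJ; split=> [Ju a|Ju].
  move: u Ju; apply: sumprod_sub => [|x y|b _ _ [h Jh <-]].
  - by rewrite frob_coord0.
  - by rewrite frob_coordD; apply: JD.
  - by rewrite mulrC frob_coordM mulrC; apply: JM.
rewrite [u]frob_coordK; apply: is_ideal_sum; first exact: ideal_span_ideal.
by move=> a _; apply: sumprod_mem => //; exists (frob_coord a u).
Qed.

(** As [c] has degree less than q, some coordinate of [c] is a nonzero constant; the same coordinate
    of c f^q is this constant times [f]. *)
Lemma frob_pow_colon (J : set S) c f : is_ideal J -> c != 0 ->
  (msize c <= q)%N -> frob_pow J (c * f ^+ q) -> J f.
Proof.
move=> iJ c0 cq /(frob_powP _ iJ) Jcf; have [J0 JD JM] := iJ.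
have [a ca] : exists a, frob_coord a c != 0.
  apply: contrapT => none; move/eqP: c0; apply; rewrite [c]frob_coordK big1 // => a _.
  have [->|ca] := eqVneq (frob_coord a c) 0; first by rewrite expr0n gtn_eqF // mulr0.
  by case: none; exists a.
have caE : frob_coord a c = mpolyC n (frob_coord a c)@_(@mnm0 n).
  apply: msize1_polyC; rewrite -mlead_deg // ltnS leqn0.
  have [m' /msize_mdeg_lt m'c] := mdeg_frob_coord (mlead_supp ca).
  by case: (mdeg _) => // k; rewrite mulSn leqNgt ltn_addr // (leq_trans m'c).
set b := (frob_coord a c)@_(@mnm0 n) in caE.
have b0 : b != 0 by move: ca; rewrite caE mpolyC_eq0.
have := JM (mpolyC n b^-1) _ (Jcf a).
by rewrite mulrC (mulrC c) frob_coordM caE -mulrA -mpolyCM divff // mulr1.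
Qed.

Lemma frob_powM (A B C : set S) x y : (forall a b, A a -> B b -> C (a * b)) ->
  frob_pow A x -> frob_pow B y -> frob_pow C (x * y).
Proof.
move=> ABC Ax By; move: x Ax; apply: sumprod_sub => [|x z|a _ _ [h Ah <-]].
- by rewrite mul0r; apply: sumprod0.
- by rewrite mulrDl; apply: sumprodD.
move: y By; apply: sumprod_sub => [|x z|b _ _ [k Bk <-]].
- by rewrite mulr0; apply: sumprod0.
- by rewrite mulrDr; apply: sumprodD.
rewrite mulrACA -exprMn; apply: sumprod_mem => //.
by exists (h * k) => //; apply: ABC.
Qed.

Lemma frob_pow_ideal (J : set S) : is_ideal (frob_pow J).
Proof. exact: ideal_span_ideal. Qed.

(** Divide each exponent by q: the [mu] remainders add up to at most mu q, so the quotients add up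
    to at least N. *)
Lemma pigeonhole_frob_pow mu (g : 'I_mu -> S) N (I := ideal_span (range g)) :
  ideal_pow I ((N + mu) * q) `<=` frob_pow (ideal_pow I N).
Proof.
rewrite /I ideal_pow_gen -/I; apply: ideal_span_sub; first exact: frob_pow_ideal.
move=> _ [c cN <-].
rewrite (_ : gmon g c = gmon g (fun i => c i %% q)%N * gmon g (fun i => c i %/ q)%N ^+ q).
  apply: sumprod_mem => //; exists (gmon g (fun i => c i %/ q)%N) => //.
  have iI : is_ideal I by exact: ideal_span_ideal.
  have Ig i : I (g i) by apply: ideal_span_mem; exists i.
  apply: ideal_pow_anti (gmon_ideal_pow _ iI Ig) => //.
  have : ((N + mu) * q <= (\sum_i c i %/ q + mu) * q)%N.
    rewrite -cN mulnDl big_distrl /= -[X in (_ <= _ + X * q)%N]card_ord -sum1_card.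
    rewrite big_distrl -big_split /=; apply: leq_sum => i _.
    by rewrite mul1n {1}(divn_eq (c i) q) leq_add2l ltnW // ltn_pmod.
  by rewrite leq_pmul2r // leq_add2r.
rewrite /gmon -prodrXl -big_split; apply: eq_bigr => i _ /=.
by rewrite -exprM -exprD addnC -divn_eq.
Qed.

End Frobenius.

(** * Two containments by tight closure *)

Section TightClosure.
Variables (F : closedFieldType) (p : nat) (charFp : p \in [pchar F]) (n mu : nat).
Local Notation S := {mpoly F[n]}.
Local Notation msize := (@mmeasure n F mdeg).
Variable g : 'I_mu -> S.
Let I := ideal_span (range g).
Let iI : is_ideal I. Proof. exact: ideal_span_ideal. Qed.
Let Ig i : I (g i). Proof. by apply: ideal_span_mem; exists i. Qed.

Let p_pow_large d : exists e, (d <= p ^ e)%N.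
Proof.
by exists d; rewrite ltnW // ltn_expl // prime_gt1 // (pcharf_prime charFp).
Qed.

(* The integral equation has degree k and ce = (c, e) encodes its term
   g^c f^e, whose coefficient is in I^((N + mu) (k - e)). It yields
   f^(k-1) f^q in I^((N + mu) q), which is in the q-th Frobenius power of I^N,
   for all q = p^e. *)
Lemma pchar_integral N k f : (0 < k)%N ->
  ideal_span ((fun ce => gmon g ce.1 * f ^+ ce.2) @`
    [set ce : ('I_mu -> nat) * nat |
      (ce.2 < k)%N /\ (\sum_i ce.1 i = (N + mu) * (k - ce.2))%N]) (f ^+ k) ->
  ideal_pow I N f.
Proof.
move=> k0; set M := (N + mu)%N => fk.
have [->|f0] := eqVneq f 0; first by have [] := ideal_pow_ideal N iI.
have powf t : ideal_pow I (M * t) (f ^+ (k.-1 + t)).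
  (* Strong induction: in f^(t+k), the factor f^k is replaced by the terms of the integral
     equation. *)
  have [t' tt'] := ubnP t; elim: t' t tt' => // t' IH [|t] tt'.
    by rewrite muln0.
  rewrite (_ : k.-1 + t.+1 = t + k)%N; last by lia.
  rewrite exprD; have [J0 JD JM] := ideal_pow_ideal (M * t.+1) iI.
  move: (f ^+ k) fk; apply: sumprod_sub => [|x y|a _ _ [[c e] /= [ek ce] <-]].
  - by rewrite mulr0.
  - by rewrite mulrDr; apply: JD.
  rewrite mulrCA; apply: (JM); rewrite mulrCA -exprD.
  have gc : ideal_pow I (M * (k - e)) (gmon g c) by rewrite -ce; apply: gmon_ideal_pow.
  (* If t + e >= k - 1, the induction hypothesis applies to f^(t+e); otherwise k - e > t and the
     factor [gmon g c] suffices. *)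
  have [ke|ke] := leqP k.-1 (t + e); last first.
    rewrite mulrC; apply: JM; apply: ideal_pow_anti gc => //.
    by rewrite leq_mul2l; apply/orP; right; lia.
  rewrite (_ : t + e = k.-1 + (t + e - k.-1))%N; last by lia.
  rewrite (_ : M * t.+1 = M * (k - e) + M * (t + e - k.-1))%N; last first.
    by rewrite -mulnDr; congr muln; lia.
  by apply: ideal_powD => //; apply: IH; lia.
have [e fe] := p_pow_large (msize (f ^+ k.-1)).
apply: (frob_pow_colon charFp (ideal_pow_ideal N iI) (expf_neq0 k.-1 f0) fe).
by apply: (pigeonhole_frob_pow charFp); have := powf (p ^ e)%N; rewrite exprD.
Qed.

(* For a = ceil(q / N), the hypothesis on L shows that f^a, hence its multiple
   f^N f^q after taking N-th powers, is in a Frobenius power. The test on h is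
   restricted to degrees at most that of f because only a test in bounded degree
   survives the specialization of the ground field. *)
Lemma pchar_symbolic N f (L : set S) : (0 < N)%N ->
  (forall l, L l -> ideal_pow I ((1 + mu) * N) (l * f)) ->
  (forall h, (msize h <= msize f)%N -> (forall l, L l -> I (l * h)) -> I h) ->
  ideal_pow I N f.
Proof.
move=> N0 Lf LI.
have [->|f0] := eqVneq f 0; first by have [] := ideal_pow_ideal N iI.
have [e fe] := p_pow_large (msize (f ^+ N)); set q := (p ^ e)%N in fe.
have q0 : (0 < q)%N by rewrite expn_gt0 prime_gt0 // (pcharf_prime charFp).
pose a := ((q + N.-1) %/ N)%N.
have qaN : (q <= a * N)%N.
  have := divn_eq (q + N.-1) N; have := ltn_pmod (q + N.-1) N0; rewrite -/a; lia.
have aNq : (a * N <= q + N)%N.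
  by rewrite /a (leq_trans (leq_divM _ _)) // leq_add2l leq_pred.
have aq : (a <= q)%N.
  by rewrite /a -ltnS ltn_divLR //; nia.
(* Each coordinate of f^a passes the test: l^q f^a = l^(q-a) (l f)^a is in I^((1+mu)Na), hence in
   I^[q], and the coordinate has degree at most a/q times that of [f]. *)
have fa : frob_pow p e I (f ^+ a).
  apply/(frob_powP charFp) => // b; apply: LI => [|l Ll].
    have [->|fb0] := eqVneq (frob_coord charFp b (f ^+ a)) 0.
      by rewrite mmeasure0.
    rewrite -!mlead_deg //.
    have [m mf mq] := mdeg_frob_coord (mlead_supp fb0).
    have : (mdeg m < msize (f ^+ a))%N by apply: msize_mdeg_lt.
    rewrite -mlead_deg ?expf_neq0 // mleadX // mdegMn !ltnS => ma.
    rewrite -(leq_pmul2r q0); apply: leq_trans mq (leq_trans ma _).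
    by rewrite leq_mul2l aq orbT.
  rewrite -frob_coordM; apply: (proj1 (frob_powP charFp e _ iI)).
  rewrite -/q -(subnK aq) exprD -mulrA -exprMn.
  have [_ _ +] := frob_pow_ideal p e I; apply.
  rewrite -[X in frob_pow _ _ X](ideal_pow1 iI).
  apply: (pigeonhole_frob_pow charFp).
  apply: ideal_pow_anti (ideal_pow_exp a iI (Lf l Ll)) => //.
  by rewrite -mulnA leq_mul2l mulnC qaN orbT.
have faN : frob_pow p e (ideal_pow I N) ((f ^+ a) ^+ N).
  elim: (N) => [|k IH].
    by rewrite -[_ ^+ 0]mulr1; apply: sumprod_mem => //; exists 1; rewrite ?expr1n.
  by rewrite exprS; apply: frob_powM fa IH => x y Ix Iy; apply: sumprod_mem.
apply: (frob_pow_colon charFp (ideal_pow_ideal N iI) (expf_neq0 N f0) fe).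
rewrite -exprD (_ : N + q = (q + N - a * N) + a * N)%N; last by lia.
rewrite exprD (exprM f a).
by have [_ _ +] := frob_pow_ideal p e (ideal_pow I N); apply.
Qed.

End TightClosure.

(** * Specialization to positive characteristic *)

Section Specialization.
Variable K : fieldType.

(* The inclusion of the kernels says that phi factors through the image of ev.
   F is any algebraically closed field whose characteristic is that of K, if K
   has positive characteristic, and does not divide N. The element d is there for
   the induction on the number of generators of P. *)
Definition specializable (P : comNzRingType) (ev : {rmorphism P -> K}) :=
  forall d : P, ev d != 0 -> exists2 N : nat, N%:R != 0 :> K &
    forall F : closedFieldType, (forall m : nat, m%:R = 0 :> K -> m%:R = 0 :> F) ->
      N%:R != 0 :> F ->
    exists phi : {rmorphism P -> F}, (forall y, ev y = 0 -> phi y = 0) /\ phi d != 0.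

Lemma specializable_int : specializable (intmul 1 : {rmorphism int -> K}).
Proof.
have absK (R : fieldType) (z : int) : (z%:~R == 0 :> R) = (`|z|%N%:R == 0 :> R).
  by case: z => k //; rewrite NegzE mulrNz oppr_eq0 abszN.
move=> z z0; exists `|z|%N => [|F KF zF]; first by rewrite -absK.
exists (intmul 1 : {rmorphism int -> F}); split; last by rewrite /= absK.
by move=> y /eqP; rewrite absK => /eqP/KF/eqP; rewrite -absK => /eqP.
Qed.

Lemma pseudo_division (P : comNzRingType) (g h : {poly P}) : h != 0 ->
  exists k Q r, lead_coef h ^+ k *: g = Q * h + r /\ (size r < size h)%N.
Proof.
move=> h0; exists (Pdiv.Ring.rscalp g h), (Pdiv.Ring.rdivp g h), (Pdiv.Ring.rmodp g h).
by rewrite Pdiv.ComRing.rdivp_eq Pdiv.Ring.ltn_rmodpN0.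
Qed.

Section Adjoin.
Variables (P : comNzRingType) (ev : {rmorphism P -> K}) (b : K).
Hypothesis spP : specializable ev.
Local Notation evb := (horner_eval b \o map_poly ev : {rmorphism {poly P} -> K}).
Local Notation mev := (map_poly ev).

(** Truncating [h] at the size of its image drops only coefficients in the kernel of [ev]. *)
Let trim (h : {poly P}) : mev h != 0 -> exists h' : {poly P},
  [/\ mev h' = mev h, size h' = size (mev h) & ev (lead_coef h') != 0].
Proof.
move=> h0; pose h' := take_poly (size (mev h)) h; exists h'.
have h'E : mev h' = mev h.
  apply/polyP => i; rewrite !coef_map coef_take_poly; case: ltnP => // hi.
  by apply: (etrans (rmorph0 ev)); rewrite -coef_map nth_default.
have sh' : size h' = size (mev h).
  apply/eqP; rewrite eqn_leq size_take_poly -{1}h'E; exact: size_poly.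
split=> //; rewrite lead_coefE sh' -coef_map h'E -lead_coefE.
by rewrite lead_coef_eq0.
Qed.

(** When [b] is transcendental over the image of [ev], the variable may be sent to any non-root of
    the image of [d], which is nonzero as soon as one coefficient of [d] survives. *)
Let specializable_transc :
  (forall h, evb h = 0 -> mev h = 0) -> specializable evb.
Proof.
move=> Ht d d0.
have [j dj] : exists j, ev d`_j != 0.
  apply: contrapT => none; move/eqP: d0; apply; rewrite /= (_ : mev d = 0) /horner_eval ?horner0 //.
  apply/polyP => j; rewrite coef_map coef0; apply/eqP/negPn/negP => dj.
  by apply: none; exists j.
have [N NK spN] := spP dj; exists N => // F KF NF.
have [phi [kerphi phidj]] := spN F KF NF.
have /closed_nonrootP[x xd] : map_poly phi d != 0.
  by apply: contraNneq phidj => d0'; rewrite -coef_map d0' coef0.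
exists (horner_eval x \o map_poly phi : {rmorphism {poly P} -> F}); split=> //.
move=> y /Ht y0 /=; rewrite (_ : map_poly phi y = 0) ?raddf0 //.
apply/polyP => i; rewrite coef_map coef0; apply: kerphi.
by rewrite -coef_map y0 coef0.
Qed.

(** When [b] is algebraic, the variable is sent to a root of the image of a minimal [h]. Modulo the
    kernel, a constant [eps] is a multiple of [d], so [d] survives if [eps] does; if the leading
    coefficient of [h] survives too, pseudo-division by [h] shows that the kernel is killed. *)
Let specializable_alg h0 : evb h0 = 0 -> mev h0 != 0 -> specializable evb.
Proof.
move=> h0b h0n0 d d0.
have evbE g : evb g = (mev g).[b] by [].
have evbZ c g : evb (c *: g) = ev c * evb g.
  by rewrite -mul_polyC rmorphM /= map_polyC /horner_eval hornerC.
pose annih s := `[< exists h : {poly P},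
  [/\ size h = s, ev (lead_coef h) != 0 & evb h = 0] >].
have exs : exists s, annih s.
  have [h [hE _ hl]] := trim h0n0; exists (size h); apply/asboolP; exists h.
  by split=> //; rewrite evbE hE.
(* h is a polynomial of least degree s - 1 which vanishes at b. *)
case/ex_minnP: exs => s /asboolP[h [hs hl hb]] smin.
set c := lead_coef h in hl.
have hn0 : h != 0 by apply: contraNneq hl => h'0; rewrite /c h'0 lead_coef0 rmorph0.
have minh g : evb g = 0 -> (size (mev g) < s)%N -> mev g = 0.
  move=> gb gs; apply/eqP/negPn/negP => /trim[g' [g'E g's g'l]].
  move: gs; rewrite -g's ltnNge => /negP; apply; apply: smin; apply/asboolP.
  by exists g'; split=> //; rewrite evbE g'E.
have divh g : evb g = 0 -> exists k Q r, c ^+ k *: g = Q * h + r /\ mev r = 0.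
  move=> gb; have [k [Q [r [E rs]]]] := pseudo_division g hn0.
  exists k, Q, r; split=> //; apply: minh; last first.
    by rewrite -hs; apply: leq_ltn_trans rs; apply: size_poly.
  by rewrite -[r](addKr (Q * h)) -E rmorphD rmorphN rmorphM hb mulr0 oppr0 add0r evbZ gb mulr0.
(* An element r of least degree which is a multiple of d modulo the kernel is
   constant, otherwise the pseudo-division of h by r gives a lower degree. *)
pose quot t := `[< exists r w : {poly P},
  [/\ size r = t, ev (lead_coef r) != 0, evb r != 0 & evb (r - d * w) = 0] >].
have quot_trim r w : evb r != 0 -> evb (r - d * w) = 0 ->
    exists2 t, (t <= size r)%N & quot t.
  move=> rb rwb; have : mev r != 0.
    by apply: contraNneq rb => r0; rewrite evbE r0 horner0.
  move=> /trim[r' [r'E r's r'l]]; exists (size r'); first by rewrite r's size_poly.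
  apply/asboolP; exists r', w; split=> //; first by rewrite evbE r'E.
  by move: rwb; rewrite !rmorphB !evbE r'E.
have ext : exists t, quot t.
  have [||t _ qt] := @quot_trim d 1; [exact: d0| |by exists t].
  by rewrite mulr1 subrr rmorph0.
case/ex_minnP: ext => t /asboolP[r [w [rt rl rb rw]]] tmin.
have {}tmin r' w' : evb r' != 0 -> evb (r' - d * w') = 0 -> (t <= size r')%N.
  by move=> r'b r'w; have [u us /tmin tu] := quot_trim _ _ r'b r'w; apply: leq_trans us.
have rn0 : r != 0 by apply: contraNneq rb => ->; rewrite rmorph0.
have mevs (g : {poly P}) : ev (lead_coef g) != 0 -> size (mev g) = size g.
  by move=> gl; apply: size_map_poly_id0.
have ts : (t < s)%N.
  rewrite ltnNge; apply/negP => st.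
  have [k [Q [r1 [E r1s]]]] := pseudo_division r hn0.
  have r1E : r1 = c ^+ k *: r - Q * h by rewrite E addrC addKr.
  have r1b : evb r1 = ev c ^+ k * evb r.
    by rewrite r1E rmorphB rmorphM hb mulr0 subr0 evbZ rmorphXn.
  have : (t <= size r1)%N.
    apply: (tmin r1 (c ^+ k *: w)); first by rewrite r1b mulf_neq0 ?expf_neq0.
    rewrite r1E -scalerAr addrAC -scalerBr rmorphB rmorphM hb mulr0 subr0.
    by rewrite evbZ rw mulr0.
  by rewrite leqNgt (leq_trans r1s) // hs.
have t1 : t = 1%N.
  apply/eqP; rewrite eqn_leq andbC -rt size_poly_gt0 rn0 rt leqNgt /=.
  apply/negP => t2; have [k [Q [r1 [E r1s]]]] := pseudo_division h rn0.
  have r1E : r1 = lead_coef r ^+ k *: h - Q * r by rewrite E addrC addKr.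
  have r1b : evb r1 = 0.
    apply/eqP/negPn/negP => r1b; have : (t <= size r1)%N.
      apply: (tmin r1 (- (Q * w))) => //; rewrite r1E.
      rewrite (_ : _ - _ = lead_coef r ^+ k *: h - Q * (r - d * w)); last by ring.
      by rewrite rmorphB rmorphM rw evbZ hb !mulr0 subr0.
    by rewrite leqNgt -rt r1s.
  have mr1 : mev r1 = 0.
    apply: minh => //; apply: leq_ltn_trans (size_poly _ _) _.
    by apply: ltn_trans r1s _; rewrite rt.
  have Qb : evb Q = 0.
    have : evb Q * evb r = 0.
      by rewrite -rmorphM -[_ * _](addrK r1) -E rmorphB evbZ hb r1b mulr0 subr0.
    by move/eqP; rewrite mulf_eq0 (negPf rb) orbF => /eqP.
  have mE : ev (lead_coef r) ^+ k *: mev h = mev Q * mev r.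
    by rewrite -rmorphXn -map_polyZ E rmorphD rmorphM /= mr1 addr0.
  have msh : size (mev h) = s by rewrite mevs.
  have mQ : mev Q != 0.
    apply/eqP => Q0; move/eqP: mE; rewrite Q0 mul0r scaler_eq0 expf_eq0 (negPf rl) andbF /=.
    by rewrite -size_poly_eq0 msh -hs size_poly_eq0 (negPf hn0).
  (* [Q] vanishes at [b], so its image has size at least s, although its product with the image of
     [r], of size t > 1, has size s. *)
  have mQs : (s <= size (mev Q))%N.
    by rewrite leqNgt; apply/negP => /(minh _ Qb)/eqP; rewrite (negPf mQ).
  have mr : size (mev r) = t by rewrite mevs.
  have : size (mev Q * mev r) = s by rewrite -mE size_scale ?expf_neq0.
  rewrite size_mul //; last by rewrite -size_poly_eq0 mr -rt size_poly_eq0.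
  rewrite mr -subn1 => sE.
  have : (s + t - 1 <= s)%N by rewrite -{2}sE leq_sub2r // leq_add2r.
  by clear - t2 ts; lia.
have rC : r = (lead_coef r)%:P by rewrite lead_coefE rt t1; apply: size1_polyC; rewrite rt t1.
set eps := lead_coef r in rC rl.
have s1 : s != 1%N.
  apply/eqP => s1; move/eqP: hl; apply; rewrite -hb (size1_polyC (p := h)) ?hs ?s1 //.
  by rewrite /c lead_coefE hs s1 /= map_polyC /horner_eval hornerC.
have [|N NK spN] := spP (d := c * eps); first by rewrite rmorphM mulf_neq0.
exists N => // F KF NF; have [phi [kerphi]] := spN F KF NF.
rewrite rmorphM mulf_eq0 negb_or => /andP[phic phieps].
have kerP (y : {poly P}) : mev y = 0 -> map_poly phi y = 0.
  move=> y0; apply/polyP => i; rewrite coef_map coef0; apply: kerphi.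
  by rewrite -coef_map y0 coef0.
have /closed_rootP[x /rootP xh] : size (map_poly phi h) != 1%N.
  by rewrite size_map_poly_id0 // hs.
pose psi : {rmorphism {poly P} -> F} := horner_eval x \o map_poly phi.
exists psi.
have kerpsi y : evb y = 0 -> psi y = 0.
  move=> /divh[k [Q [r1 [E /kerP r10]]]].
  have : psi (c ^+ k *: y) = 0.
    by rewrite E rmorphD rmorphM /psi /= r10 /horner_eval xh mulr0 horner0 addr0.
  have ck : phi (c ^+ k) != 0 by rewrite rmorphXn expf_neq0.
  rewrite -mul_polyC rmorphM => /eqP; rewrite mulf_eq0 => /orP[|/eqP//].
  by rewrite /psi /= map_polyC /horner_eval hornerC => ck0; case/negP: ck.
split=> //; apply/eqP => psid; move/eqP: phieps; apply.
have := kerpsi _ rw; rewrite rmorphB rmorphM psid mul0r subr0 rC.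
by rewrite /psi /= map_polyC /horner_eval hornerC.
Qed.

Lemma specializable_poly : specializable evb.
Proof.
have [Ht|] := pselect (forall h, evb h = 0 -> mev h = 0).
  exact: specializable_transc.
move=> /existsNP[h /not_implyP[hb /eqP h0]].
exact: specializable_alg hb h0.
Qed.

End Adjoin.

Lemma specializable_seq (s : seq K) :
  exists (P : comNzRingType) (ev : {rmorphism P -> K}),
    specializable ev /\ forall x, x \in s -> exists y, ev y = x.
Proof.
elim: s => [|b s [P [ev [spP sP]]]].
  by exists int, (intmul 1 : {rmorphism int -> K}); split=> //; exact: specializable_int.
exists {poly P}, (horner_eval b \o map_poly ev : {rmorphism {poly P} -> K}).
split; first exact: specializable_poly.
move=> x; rewrite inE => /orP[/eqP->|/sP[y <-]].
  by exists 'X; rewrite /= map_polyX /horner_eval hornerX.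
by exists y%:P; rewrite /= map_polyC /horner_eval hornerC.
Qed.

Lemma specialization (s : seq K) :
  exists (P : comNzRingType) (ev : {rmorphism P -> K})
    (F : closedFieldType) (phi : {rmorphism P -> F}) (p : nat),
  [/\ p \in [pchar F], forall y, ev y = 0 -> phi y = 0 &
      forall x, x \in s -> exists y, ev y = x].
Proof.
have [P [ev [spP sP]]] := specializable_seq s.
have [|N NK spN] := spP 1; first by rewrite rmorph1 oner_eq0.
(* p is the characteristic of K if this is positive, and a prime exceeding N otherwise. *)
suff [p pp [pK pN]] : exists2 p, prime p &
    (forall m : nat, m%:R = 0 :> K -> (p %| m)%N) /\ ~~ (p %| N)%N.
  have [F [f _]] := countable_algebraic_closure 'F_p.
  have pF : p \in [pchar F] by apply/(rmorph_pchar f)/pchar_Fp.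
  have [||phi [kerphi _]] := spN F.
  - by move=> m /pK; rewrite (dvdn_pcharf pF) => /eqP.
  - by rewrite -(dvdn_pcharf pF).
  by exists P, ev, F, phi, p; split.
have [[p pK]|K0] := pselect (exists p, p \in [pchar K]).
  exists p; first exact: pcharf_prime pK.
  by rewrite (dvdn_pcharf pK); split=> // m m0; rewrite (dvdn_pcharf pK) m0.
have {}K0 : [pchar K] =i pred0.
  by move=> p; apply/negP => pK; apply: K0; exists p.
have K0P := (pcharf0P K).1 K0.
have N0 : (0 < N)%N by rewrite lt0n -K0P.
have [p Np pp] := prime_above N; exists p => //; split.
  by move=> m /eqP; rewrite K0P => /eqP->; rewrite dvdn0.
by rewrite gtnNdvd.
Qed.

End Specialization.

(** * Linear functionals vanishing on homogeneous ideals *)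

Section HomogeneousPowers.
Variables (K : fieldType) (n : nat).
Implicit Types (I J : set {mpoly K[n]}).

Lemma homogeneous_sumprod I J :
  homogeneous I -> homogeneous J -> homogeneous (sumprod I J).
Proof.
move=> hI hJ f IJf d; move: f IJf; apply: sumprod_sub => [|x y|a b Ia Jb].
- by rewrite linear0; apply: sumprod0.
- by rewrite linearD; apply: sumprodD.
rewrite [a](pihomog_partitionE (leqnn (mmeasure mdeg a))).
rewrite [b](pihomog_partitionE (leqnn (mmeasure mdeg b))).
rewrite mulr_suml linear_sum; apply: (big_ind (sumprod I J)).
- exact: sumprod0.
- exact: sumprodD.
move=> i _; rewrite mulr_sumr linear_sum; apply: (big_ind (sumprod I J)).
- exact: sumprod0.
- exact: sumprodD.
move=> j _; have ij := dhomogM (pihomogP mdeg i a) (pihomogP mdeg j b).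
have [<-|ijd] := eqVneq (i + j)%N d.
  by rewrite [X in sumprod I J X](pihomog_dE ij); apply: sumprod_mem; [apply: hI|apply: hJ].
by rewrite [X in sumprod I J X](pihomog_ne0 ijd ij); apply: sumprod0.
Qed.

Lemma homogeneous_ideal_pow I s : homogeneous I -> homogeneous (ideal_pow I s).
Proof. by move=> hI; elim: s => // s IH; apply: homogeneous_sumprod. Qed.

End HomogeneousPowers.

Section CoefficientPairing.
Variables (R : comNzRingType) (n : nat).
Local Notation S := {mpoly R[n]}.

(** The polynomial [u] encodes a functional of finite support, which can thus be specialized like
    any polynomial. *)
Definition dot (u h : S) : R := mpoly_ext (fun m c => u@_m * c) h.

Lemma dotD u : {morph dot u : h k / h + k}.
Proof. by move=> h k; apply: mpoly_extD => *; rewrite ?mulr0 ?mulrDr. Qed.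

Lemma dot0 u : dot u 0 = 0. Proof. exact: mpoly_ext0. Qed.

Lemma dotX u c m : dot u (c *: 'X_[m]) = u@_m * c.
Proof. by apply: mpoly_extX => *; rewrite mulr0. Qed.

Lemma dotZ u c h : dot u (c *: h) = c * dot u h.
Proof.
elim/mpolyind: h => [|d m h _ _ IH]; first by rewrite scaler0 dot0 mulr0.
by rewrite scalerDr !dotD IH scalerA !dotX mulrDr mulrCA.
Qed.

Lemma dotDl u v h : dot (u + v) h = dot u h + dot v h.
Proof. by rewrite -big_split; apply: eq_bigr => m _; rewrite mcoeffD mulrDl. Qed.

Lemma dot0l h : dot 0 h = 0.
Proof. by rewrite /dot /mpoly_ext big1 // => m _; rewrite mcoeff0 mul0r. Qed.

Lemma dotZl c u h : dot (c *: u) h = c * dot u h.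
Proof. by rewrite mulr_sumr; apply: eq_bigr => m _; rewrite mcoeffZ mulrA. Qed.

Lemma dot_mcoeff m h : dot 'X_[m] h = h@_m.
Proof.
elim/mpolyind: h => [|c k h _ _ IH]; first by rewrite dot0 mcoeff0.
by rewrite dotD IH dotX mcoeffX mcoeffD mcoeffZ mcoeffX eq_sym mulrC.
Qed.

End CoefficientPairing.

Section Separation.
Variables (K : fieldType) (n : nat).
Local Notation S := {mpoly K[n]}.
Implicit Types (J : set S).

Lemma mcoeff_pihomog d (f : S) m :
  (pihomog mdeg d f)@_m = if mdeg m == d then f@_m else 0.
Proof.
elim/mpolyind: f => [|c k f _ _ IH]; first by rewrite linear0 mcoeff0 if_same.
rewrite linearD mcoeffD IH linearZ /= pihomogX !mcoeffD !mcoeffZ.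
have [<-|kd] := eqVneq (mdeg k) d.
  rewrite mcoeffX; have [->|km] := eqVneq k m; first by rewrite eqxx.
  by case: ifP; rewrite ?mulr0 ?addr0.
rewrite mcoeff0 mulr0 add0r mcoeffX.
case: ifP => // /eqP md; case: eqVneq => [km|_]; last by rewrite mulr0 add0r.
by rewrite km md eqxx in kd.
Qed.

(** The rows of [A] form a largest linearly independent family in [W]. *)
Lemma submx_of_subspace N (W : set 'rV[K]_N) :
  exists k (A : 'M[K]_(k, N)), (forall i, W (row i A)) /\
    forall w, W w -> (w <= A)%MS.
Proof.
pose Q k := `[< exists A : 'M[K]_(k, N), row_free A /\ forall i, W (row i A) >].
have exQ : exists k, Q k.
  exists 0%N; apply/asboolP; exists (0 : 'M[K]_(0, N)).
  by split=> [|[]//]; rewrite /row_free mxrank0.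
have QN k : Q k -> (k <= N)%N.
  by move=> /asboolP[A [/eqP Ak _]]; rewrite -{1}Ak; apply: rank_leq_col.
case: (ex_maxnP exQ QN) => k /asboolP[A [Afree AW]] kmax.
exists k, A; split=> // w Ww; apply: contraT => wA.
have : Q (k + 1)%N.
  apply/asboolP; exists (col_mx A w); split.
    rewrite /row_free -addsmxE eqn_leq.
    rewrite {1}addsmxE rank_leq_row /= addn1 -[X in (X < _)%N](eqP Afree).
    apply: rank_ltmx; rewrite ltmxE addsmxSl /=; apply: contra wA.
    exact/submx_trans/addsmxSr.
  move=> i; rewrite -(fintype.splitK i); case: (fintype.split i) => j /=.
    by rewrite rowKu.
  by rewrite rowKd ord1 row_id.
by move=> /kmax; rewrite addn1 ltnn.
Qed.

(** Some component f_d is outside J. By homogeneity it is not the degree d component of an element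
    of J, and in this finite-dimensional space a column of a cokernel separates it from all of
    those. *)
Lemma homogeneous_separation J (f : S) : is_ideal J -> homogeneous J -> ~ J f ->
  exists u, dot u f = 1 /\ forall h, J h -> dot u h = 0.
Proof.
move=> iJ hJ Jf; have [J0 JD JM] := iJ.
have JZ c h : J h -> J (c *: h) by rewrite -mul_mpolyC; apply: JM.
have [d Jfd] : exists d, ~ J (pihomog mdeg d f).
  apply: contrapT => none; apply: Jf.
  rewrite [f](pihomog_partitionE (leqnn (mmeasure mdeg f))).
  apply: is_ideal_sum => // d _; apply: contrapT => Jfd.
  by apply: none; exists (d : nat).
pose B : finType := bmultinom n d.+1; pose N := #|B|.
pose mn (i : 'I_N) : multinom n := bmnm (enum_val i : B).
pose rowof (h : S) : 'rV[K]_N := \row_i (pihomog mdeg d h)@_(mn i).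
have [k [A [AW WA]]] := submx_of_subspace (rowof @` J).
have rowofD : {morph rowof : x y / x + y}.
  by move=> x y; apply/rowP => i; rewrite !mxE linearD mcoeffD.
have rowofZ c x : rowof (c *: x) = c *: rowof x.
  by apply/rowP => i; rewrite !mxE linearZ mcoeffZ.
have rowof_inj x y : rowof x = rowof y -> pihomog mdeg d x = pihomog mdeg d y.
  move=> xy; apply/mpolyP => m; have [md|md] := eqVneq (mdeg m) d; last first.
    by rewrite !mcoeff_pihomog (negPf md).
  have mB : (mdeg m < d.+1)%N by rewrite md.
  have := congr1 (fun r : 'rV[K]_N => r 0 (enum_rank (BMultinom mB : bmultinom n d.+1))) xy.
  by rewrite !mxE /mn enum_rankK.
have rfA : ~~ (rowof f <= A)%MS.
  apply/negP => /submxP[D fE]; apply: Jfd.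
  have [h Jh hE] : exists2 h, J h & rowof h = rowof f.
    rewrite fE mulmx_sum_row.
    apply: (big_ind (fun r => exists2 h, J h & rowof h = r)).
    - by exists 0 => //; apply/rowP => i; rewrite !mxE linear0 mcoeff0.
    - by move=> _ _ [x Jx <-] [y Jy <-]; exists (x + y); rewrite ?rowofD //; apply: JD.
    - move=> i _; have [h Jh hE] := AW i.
      by exists (D 0 i *: h); [apply: JZ|rewrite rowofZ hE].
  by rewrite -(rowof_inj _ _ hE); apply: hJ.
have [j jf] : exists j, (rowof f *m cokermx A) 0 j != 0.
  apply: contrapT => none; move/negP: rfA; apply; rewrite submxE; apply/eqP/rowP => j.
  by rewrite [RHS]mxE; apply/eqP/negPn/negP => jf; apply: none; exists j.
pose a := (rowof f *m cokermx A) 0 j.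
pose u : S := \sum_i (if mdeg (mn i) == d then a^-1 * cokermx A i j else 0) *: 'X_[mn i].
have dotu h : dot u h = a^-1 * (rowof h *m cokermx A) 0 j.
  rewrite /u (big_morph (fun v => dot v h) (fun v w => dotDl v w h) (dot0l h)).
  rewrite mxE mulr_sumr; apply: eq_bigr => i _.
  rewrite dotZl dot_mcoeff !mxE mcoeff_pihomog; case: ifP => _.
    by rewrite -mulrA; congr (_ * _); apply: mulrC.
  by rewrite !mul0r mulr0.
exists u; split=> [|h Jh]; first by rewrite dotu mulVf.
have /WA : (rowof @` J) (rowof h) by exists h.
by rewrite dotu submxE => /eqP->; rewrite mxE mulr0.
Qed.

End Separation.

(** * Finite certificates for an implication between memberships *)

Section Reduction.
Variables (R : comNzRingType) (n : nat).
Local Notation S := {mpoly R[n]}.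

(* The list c certifies that h is in I as soon as l h is in I for all its first
   components l: the functionals dot u kill I, so such an h is equal to
   reduce c h, and reduce c maps the polynomials of bounded degree to I. Unlike
   the implication itself, this is a finite set of polynomial identities. *)
Fixpoint reduce (c : seq (S * S * S)) (h : S) : S :=
  if c is (l, u, e) :: c' then
    let r := reduce c' h in r - dot u (l * r) *: e
  else h.

Lemma reduceD c : {morph reduce c : h k / h + k}.
Proof.
elim: c => //= -[[l u] e] c IH h k.
by rewrite IH mulrDr dotD scalerDl opprD addrACA.
Qed.

Lemma reduceZ c a h : reduce c (a *: h) = a *: reduce c h.
Proof.
elim: c => //= -[[l u] e] c ->.
by rewrite -scalerAr dotZ -scalerA scalerBr.
Qed.

Lemma reduce0 c : reduce c 0 = 0.
Proof. by have := reduceZ c 0 0; rewrite !scale0r. Qed.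

Lemma reduce_id c h : (forall z, z \in c -> dot z.1.2 (z.1.1 * h) = 0) ->
  reduce c h = h.
Proof.
elim: c => //= -[[l u] e] c IH zh; rewrite IH => [|z zc]; last first.
  by apply: zh; rewrite inE zc orbT.
by rewrite (zh _ (mem_head _ _)) scale0r subr0.
Qed.

End Reduction.

Section MapReduction.
Variables (R R' : comNzRingType) (phi : {rmorphism R -> R'}) (n : nat).
Local Notation mphi := (map_mpoly phi : {mpoly R[n]} -> {mpoly R'[n]}).

Lemma map_mpoly_scaleX c (m : multinom n) : mphi (c *: 'X_[m]) = phi c *: 'X_[m].
Proof. by rewrite map_mpolyZ map_mpolyX. Qed.

Lemma dot_map u h : dot (mphi u) (mphi h) = phi (dot u h).
Proof.
elim/mpolyind: h => [|c m h _ _ IH]; first by rewrite rmorph0 !dot0 rmorph0.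
rewrite rmorphD /= !dotD IH rmorphD; congr (_ + _).
by rewrite map_mpoly_scaleX !dotX mcoeff_map_mpoly rmorphM.
Qed.

Lemma reduce_map (c : seq ({mpoly R[n]} * {mpoly R[n]} * {mpoly R[n]})) h :
  mphi (reduce c h) = reduce [seq (mphi z.1.1, mphi z.1.2, mphi z.2) | z <- c] (mphi h).
Proof.
elim: c => //= -[[l u] e] c IH /=.
by rewrite rmorphB /= map_mpolyZ -IH -rmorphM dot_map.
Qed.

Lemma map_gmon mu (g : 'I_mu -> {mpoly R[n]}) c :
  mphi (gmon g c) = gmon (mphi \o g) c.
Proof. by rewrite rmorph_prod; apply: eq_bigr => i _; rewrite rmorphXn. Qed.

Lemma map_gmons mu (g : 'I_mu -> {mpoly R[n]}) m :
  mphi @` gmons g m = gmons (mphi \o g) m.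
Proof.
apply/seteqP; split=> x.
  by move=> [_ [c cm <-] <-]; exists c; rewrite // map_gmon.
by move=> [c cm <-]; exists (gmon g c); [exists c|rewrite map_gmon].
Qed.

End MapReduction.

Section Certificate.
Variables (K : fieldType) (n : nat).
Local Notation S := {mpoly K[n]}.
Variables (I L : set S).
Hypotheses (iI : is_ideal I) (hI : homogeneous I).
Hypothesis LI : forall h, (forall l, L l -> I (l * h)) -> I h.

(** If some l times the reduction of [h] is outside I, a functional separating it from I yields an
    entry that reduces [h] to 0. What is already reduced into I stays there, since the functional
    kills I. *)
Lemma exists_reduction (hs : seq S) : exists c : seq (S * S * S),
  (forall z, z \in c -> L z.1.1 /\ forall x, I x -> dot z.1.2 x = 0) /\
  (forall h, h \in hs -> I (reduce c h)).
Proof.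
elim: hs => [|h hs [c [cL cI]]]; first by exists [::].
have [Ih|Ih] := pselect (I (reduce c h)).
  by exists c; split=> // k; rewrite inE => /orP[/eqP->//|/cI].
have [l Ll Ilh] : exists2 l, L l & ~ I (l * reduce c h).
  apply: contrapT => none; apply: Ih; apply: LI => l Ll.
  by apply: contrapT => Ilh; apply: none; exists l.
have [u [u1 uI]] := homogeneous_separation iI hI Ilh.
exists ((l, u, reduce c h) :: c); split=> [z|k].
  by rewrite inE => /orP[/eqP->//|/cL].
rewrite inE => /orP[/eqP->|/cI Ik] /=.
  by rewrite u1 scale1r subrr; case: iI.
by rewrite uI ?scale0r ?subr0 //; case: iI => _ _; apply.
Qed.

End Certificate.

(** * Transfer of identities, functionals and degrees *)

Section Transfer.
Variables (K : fieldType) (n : nat).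

(** [lift] is a mere choice of preimages: relations in [U] hold for the lifts only after applying
    [ev], and [transfer_eq] carries them to F. *)
Lemma mpoly_specialization (U : seq {mpoly K[n]}) :
  exists (P : comNzRingType) (ev : {rmorphism P -> K})
    (F : closedFieldType) (phi : {rmorphism P -> F}) (p : nat)
    (lift : {mpoly K[n]} -> {mpoly P[n]}),
  [/\ p \in [pchar F], forall y, ev y = 0 -> phi y = 0 &
      forall u, u \in U -> map_mpoly ev (lift u) = u].
Proof.
pose coefs := flatten [seq [seq u@_m | m <- msupp u] | u : {mpoly K[n]} <- U].
have [P [ev [F [phi [p [pF ker cov]]]]]] := specialization coefs.
have /choice[lift liftP] : forall u, exists w, u \in U -> map_mpoly ev w = u.
  move=> u; have [uU|] := boolP (u \in U); last by exists 0.
  have /choice[l lP] : forall m, exists y, m \in msupp u -> ev y = u@_m.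
    move=> m; have [mu|] := boolP (m \in msupp u); last by exists 0.
    have [|y yE] := cov u@_m; last by exists y.
    by apply/flattenP; exists [seq u@_k | k <- msupp u]; apply/map_f.
  exists (\sum_(m <- msupp u) l m *: 'X_[m]) => _.
  rewrite rmorph_sum {2}[u]mpolyE; apply: eq_big_seq => m mu.
  by rewrite /= map_mpoly_scaleX lP.
by exists P, ev, F, phi, p, lift.
Qed.

Variables (P : comNzRingType) (ev : {rmorphism P -> K}) (F : closedFieldType).
Variable phi : {rmorphism P -> F}.
Hypothesis ker : forall y, ev y = 0 -> phi y = 0.
Local Notation mev := (map_mpoly ev : {mpoly P[n]} -> {mpoly K[n]}).
Local Notation mphi := (map_mpoly phi : {mpoly P[n]} -> {mpoly F[n]}).

Lemma transfer_eq A B : mev A = mev B -> mphi A = mphi B.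
Proof.
move=> AB; apply/eqP; rewrite -subr_eq0; apply/eqP; rewrite -rmorphB.
apply/mpolyP => m; rewrite mcoeff_map_mpoly mcoeff0; apply: ker.
by rewrite -mcoeff_map_mpoly rmorphB /= AB subrr mcoeff0.
Qed.

Lemma transfer_dot1 u h : dot (mev u) (mev h) = 1 -> dot (mphi u) (mphi h) = 1.
Proof.
rewrite !dot_map => uh; apply/eqP; rewrite -subr_eq0 -(rmorph1 phi) -rmorphB.
by apply/eqP/ker; rewrite rmorphB uh rmorph1 subrr.
Qed.

(** By linearity over F, only products of monomials and elements of [X] matter; these come from P,
    where the value of the functional is in the kernel of [ev]. *)
Lemma transfer_annihilator (X : set {mpoly P[n]}) u :
  (forall h, ideal_span (mev @` X) h -> dot (mev u) h = 0) ->
  forall h, ideal_span (mphi @` X) h -> dot (mphi u) h = 0.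
Proof.
move=> uX; apply: sumprod_sub => [|x y|a _ _ [b Xb <-]].
- exact: dot0.
- by rewrite dotD => -> ->; rewrite addr0.
elim/mpolyind: a => [|c m a _ _ IH]; first by rewrite mul0r dot0.
rewrite mulrDl dotD IH addr0 -scalerAl dotZ.
have -> : dot (mphi u) ('X_[m] * mphi b) = phi (dot u ('X_[m] * b)).
  by rewrite -dot_map rmorphM /= map_mpolyX.
rewrite (ker (y := dot u ('X_[m] * b))) ?mulr0 // -dot_map.
by apply: uX; rewrite rmorphM /= map_mpolyX; apply: sumprod_mem => //; exists b.
Qed.

Lemma transfer_msize w : (mmeasure mdeg (mphi w) <= mmeasure mdeg (mev w))%N.
Proof.
rewrite [X in (X <= _)%N]/mmeasure big_seq; apply/bigmax_leqP_seq => m _.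
move=> mw; apply: msize_mdeg_lt; rewrite mcoeff_msupp mcoeff_map_mpoly.
by apply: contraTneq mw => /ker w0; rewrite -mcoeff_eq0 mcoeff_map_mpoly; apply/eqP.
Qed.

End Transfer.

(** * Containments over an arbitrary field *)

Section Containments.
Variables (K : fieldType) (n mu : nat) (g : 'I_mu -> {mpoly K[n]}).
Let I := ideal_span (range g).
Let iI : is_ideal I. Proof. exact: ideal_span_ideal. Qed.
Hypothesis hI : homogeneous I.
Local Notation gterm g f := (fun ce : ('I_mu -> nat) * nat => gmon g ce.1 * f ^+ ce.2).

(** The data specialized are [f], the generators, the coefficients of the integral equation and a
    functional separating [f] from I^N. Its value at [f] remains 1, but is 0 by [pchar_integral]. *)
Lemma integral_ideal_pow N k f : (0 < k)%N ->
  ideal_span (gterm g f @` [set ce | (ce.2 < k)%N /\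
     (\sum_i ce.1 i = (N + mu) * (k - ce.2))%N]) (f ^+ k) ->
  ideal_pow I N f.
Proof.
move=> k0 /ideal_span_seqP[s [sP fk]]; apply: contrapT => IfN.
have [u [uf uI]] := homogeneous_separation (ideal_pow_ideal N iI)
  (@homogeneous_ideal_pow _ _ _ N hI) IfN.
have [P [ev [F [phi [p [lift [pF ker liftP]]]]]]] :=
  mpoly_specialization ([:: f; u] ++ codom g ++ [seq z.1 | z <- s]).
have liftf : map_mpoly ev (lift f) = f by apply: liftP; rewrite !inE eqxx.
have liftu : map_mpoly ev (lift u) = u by apply: liftP; rewrite !inE eqxx orbT.
have liftg : map_mpoly ev \o (lift \o g) = g.
  apply/funext => i; apply: liftP.
  by rewrite mem_cat mem_cat codom_f orbT.
have lifts i z0 : (i < size s)%N -> map_mpoly ev (lift (nth z0 s i).1) = (nth z0 s i).1.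
  by move=> si; apply: liftP; rewrite !mem_cat map_f ?orbT // mem_nth.
pose h := map_mpoly phi \o (lift \o g).
have : ideal_pow (ideal_span (range h)) N (map_mpoly phi (lift f)).
  apply: (pchar_integral pF k0).
  pose z0 : {mpoly K[n]} * (('I_mu -> nat) * nat) := (0, (fun=> 0%N, 0%N)).
  have -> : map_mpoly phi (lift f) ^+ k = \sum_(i < size s) map_mpoly phi (lift (nth z0 s i).1) *
      gterm h (map_mpoly phi (lift f)) (nth z0 s i).2.
    have -> : map_mpoly phi (lift f) ^+ k = map_mpoly phi (lift f ^+ k) by rewrite rmorphXn.
    under eq_bigr => i _ do rewrite -map_gmon -rmorphXn -!rmorphM.
    rewrite -rmorph_sum; apply: (transfer_eq ker).
    rewrite rmorphXn rmorph_sum /= liftf fk (big_nth z0) big_mkord.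
    apply: eq_bigr => i _; rewrite !rmorphM rmorphXn /= liftf lifts //.
    by rewrite map_gmon liftg.
  apply: is_ideal_sum; first exact: ideal_span_ideal.
  move=> i _; apply: sumprod_mem => //; exists (nth z0 s i).2 => //.
  exact: sP.
rewrite ideal_pow_gen -map_gmons => If.
have := transfer_dot1 ker (u := lift u) (h := lift f).
rewrite liftf liftu => /(_ uf) /eqP.
rewrite (transfer_annihilator ker _ If) => [|x]; first by rewrite eq_sym oner_eq0.
by rewrite liftu map_gmons liftg -ideal_pow_gen; apply: uI.
Qed.

(** The test [LI] quantifies over all h and cannot be specialized itself. A certificate on the
    monomials of degree at most that of [f] replaces it, along with identities [t] for the
    memberships in I^M and [b] for the reduced monomials. *)
Lemma symbolic_sub_ideal_pow N : (0 < N)%N ->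
  symbolic_pow I ((1 + mu) * N) `<=` ideal_pow I N.
Proof.
move=> N0 f If; apply: contrapT => IfN.
pose M := ((1 + mu) * N)%N; pose msize := @mmeasure n K mdeg.
pose L := [set l | ideal_pow I M (l * f)].
have LI h : (forall l, L l -> I (l * h)) -> I h.
  by move=> lh; apply: (symbolic_pow_colon (@hilbert_basis K n) iI If).
have [u [uf uI]] := homogeneous_separation (ideal_pow_ideal N iI)
  (@homogeneous_ideal_pow _ _ _ N hI) IfN.
pose mons := [seq ('X_[bmnm m] : {mpoly K[n]}) | m <- enum {: bmultinom n (msize f)}].
have [c [cL cI]] := exists_reduction iI hI LI mons.
have /choice[t tP] : forall l : {mpoly K[n]}, exists t : seq ({mpoly K[n]} * ('I_mu -> nat)),
    L l -> (forall i, (i < size t)%N -> forall z0, (\sum_j (nth z0 t i).2 j = M)%N) /\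
      l * f = \sum_(z <- t) z.1 * gmon g z.2.
  move=> l; have [|Ll] := pselect (L l); last by exists [::].
  by rewrite /L /= ideal_pow_gen => /ideal_span_seqP[t [tM lf]]; exists t.
have /choice[b bP] : forall h : {mpoly K[n]}, exists b : seq ({mpoly K[n]} * 'I_mu),
    h \in mons -> reduce c h = \sum_(z <- b) z.1 * g z.2.
  move=> h; have [/cI|] := boolP (h \in mons); last by exists [::].
  by move=> /ideal_span_seqP[b [_ hE]]; exists b.
pose U := [:: f; u] ++ codom g ++ flatten [seq [:: z.1.1; z.1.2; z.2] | z <- c]
  ++ flatten [seq [seq y.1 | y <- t z.1.1] | z <- c]
  ++ flatten [seq [seq y.1 | y <- b h] | h <- mons].
have [P [ev [F [phi [p [lift [pF ker liftP]]]]]]] := mpoly_specialization U.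
have liftf : map_mpoly ev (lift f) = f by apply: liftP; rewrite !inE eqxx.
have liftu : map_mpoly ev (lift u) = u by apply: liftP; rewrite !inE eqxx orbT.
have liftg : map_mpoly ev \o (lift \o g) = g.
  apply/funext => i; apply: liftP.
  by rewrite mem_cat mem_cat codom_f orbT.
have liftc z : z \in c -> [/\ map_mpoly ev (lift z.1.1) = z.1.1,
    map_mpoly ev (lift z.1.2) = z.1.2 & map_mpoly ev (lift z.2) = z.2].
  move=> zc; have zU x : x \in [:: z.1.1; z.1.2; z.2] -> map_mpoly ev (lift x) = x.
    move=> xz; apply: liftP; rewrite !mem_cat; apply/orP; right; apply/orP; right.
    apply/orP; left; apply/flattenP; exists [:: z.1.1; z.1.2; z.2] => //.
    exact: (map_f (fun z => [:: z.1.1; z.1.2; z.2])).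
  by split; apply: zU; rewrite !inE eqxx ?orbT.
have liftt z i z0 : z \in c -> (i < size (t z.1.1))%N ->
    map_mpoly ev (lift (nth z0 (t z.1.1) i).1) = (nth z0 (t z.1.1) i).1.
  move=> zc it; apply: liftP; rewrite !mem_cat; do 3 (apply/orP; right).
  apply/orP; left; apply/flattenP; exists [seq y.1 | y <- t z.1.1].
    exact: (map_f (fun z => [seq y.1 | y <- t z.1.1])).
  by apply: map_f; rewrite mem_nth.
have liftb h y : h \in mons -> y \in b h -> map_mpoly ev (lift y.1) = y.1.
  move=> hm yb; apply: liftP; rewrite !mem_cat; do 4 (apply/orP; right).
  apply/flattenP; exists [seq y.1 | y <- b h].
    exact: (map_f (fun h => [seq y.1 | y <- b h])).
  exact: map_f.
pose h := map_mpoly phi \o (lift \o g).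
pose J := ideal_span (range h).
pose cF := [seq (map_mpoly phi (lift z.1.1), map_mpoly phi (lift z.1.2),
  map_mpoly phi (lift z.2)) | z <- c].
(* Over F, [L] is replaced by the finitely many multipliers of the certificate. *)
pose LF := [set l | exists2 z, z \in c & l = map_mpoly phi (lift z.1.1)].
have rangeE (R : comNzRingType) (f1 : {mpoly P[n]} -> R) :
    f1 @` range (lift \o g) = range (f1 \o (lift \o g)).
  by rewrite image_comp.
have LFf l : LF l -> ideal_pow J M (l * map_mpoly phi (lift f)).
  move=> [z zc ->]; have [/tP[tM lf] _] := cL z zc.
  pose z0 : {mpoly K[n]} * ('I_mu -> nat) := (0, fun=> 0%N).
  have -> : map_mpoly phi (lift z.1.1) * map_mpoly phi (lift f) = \sum_(i < size (t z.1.1))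
      map_mpoly phi (lift (nth z0 (t z.1.1) i).1) * gmon h (nth z0 (t z.1.1) i).2.
    under eq_bigr => i _ do rewrite -map_gmon -rmorphM.
    rewrite -rmorphM -rmorph_sum; apply: (transfer_eq ker).
    have [z1 _ _] := liftc z zc.
    rewrite rmorphM rmorph_sum /= liftf z1 lf (big_nth z0) big_mkord.
    apply: eq_bigr => i _; rewrite rmorphM /= liftt //.
    by rewrite map_gmon liftg.
  rewrite ideal_pow_gen; apply: is_ideal_sum; first exact: ideal_span_ideal.
  move=> i _; apply: sumprod_mem => //; exists (nth z0 (t z.1.1) i).2 => //.
  exact: tM.
(* The functionals vanish on the multiples of an [x] that passes the test, so [x] is its own
   reduction; by linearity it is in J, since the reduced monomials are. *)
have JI x : (mmeasure mdeg x <= mmeasure mdeg (map_mpoly phi (lift f)))%N ->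
    (forall l, LF l -> J (l * x)) -> J x.
  move=> xf lx; have <- : reduce cF x = x.
    apply: reduce_id => _ /mapP[z zc ->] /=.
    have [_ zI] := cL z zc; have [_ z2 _] := liftc z zc.
    have Jlx : ideal_span (map_mpoly phi @` range (lift \o g)) (map_mpoly phi (lift z.1.1) * x).
      by rewrite rangeE; apply: lx; exists z.
    apply: (transfer_annihilator ker _ Jlx) => y.
    by rewrite z2 rangeE liftg; apply: zI.
  rewrite (@mpolywE _ _ (msize f) x); last first.
    by apply: leq_trans xf _; rewrite -[in X in (_ <= X)%N]liftf; apply: transfer_msize.
  rewrite (big_morph _ (reduceD cF) (reduce0 cF)).
  apply: is_ideal_sum; first exact: ideal_span_ideal.
  move=> m _; rewrite reduceZ -mul_mpolyC.
  have [_ _ JM] := ideal_span_ideal (range h); apply: JM.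
  have mm : ('X_[bmnm m] : {mpoly K[n]}) \in mons by apply: map_f; rewrite mem_enum.
  have -> : reduce cF 'X_[bmnm m] =
      \sum_(y <- b 'X_[bmnm m]) map_mpoly phi (lift y.1) * h y.2.
    under eq_bigr => y _ do rewrite -rmorphM.
    rewrite -rmorph_sum.
    have -> : reduce cF 'X_[bmnm m] = map_mpoly phi (reduce
        [seq (lift z.1.1, lift z.1.2, lift z.2) | z <- c] 'X_[bmnm m]).
      by rewrite reduce_map -map_comp map_mpolyX.
    apply: (transfer_eq ker); rewrite reduce_map -map_comp map_mpolyX rmorph_sum /=.
    rewrite (_ : map _ c = c) ?bP //; last first.
      rewrite -[RHS]map_id; apply/eq_in_map => z zc /=.
      by have [-> -> ->] := liftc z zc; case: z zc => -[].
    apply: eq_big_seq => y yb; rewrite rmorphM /= (liftb _ _ mm yb).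
    by rewrite -[in LHS]liftg.
  apply: is_ideal_sum; first exact: ideal_span_ideal.
  by move=> y _; apply: sumprod_mem => //; exists y.2.
have := pchar_symbolic pF N0 LFf JI.
rewrite ideal_pow_gen -map_gmons => Jf.
have := transfer_dot1 ker (u := lift u) (h := lift f).
rewrite liftf liftu => /(_ uf) /eqP.
rewrite (transfer_annihilator ker _ Jf) => [|x]; first by rewrite eq_sym oner_eq0.
by rewrite liftu map_gmons liftg -ideal_pow_gen; apply: uI.
Qed.

End Containments.

(** * Valuations and asymptotic resurgence *)

Section Subadditive.
Variable R : realType.

(** Fekete's lemma: u t is compared with (t / s) u s for an s whose quotient is close to the
    infimum. *)
Lemma fekete (u : nat -> R) : (forall s, 0 <= u s) ->
  (forall s t, u (s + t)%N <= u s + u t) ->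
  exists l, [/\ (fun s => u s / s%:R) @ \oo --> l,
    forall s, (0 < s)%N -> l <= u s / s%:R &
    forall c, (forall s, (0 < s)%N -> c <= u s / s%:R) -> c <= l].
Proof.
move=> u0 uD; pose A := [set u s / s%:R | s in [set s | (0 < s)%N]].
have Alb : has_lbound A.
  by exists 0 => _ [s _ <-]; rewrite divr_ge0 ?ler0n.
have A0 : A !=set0 by exists (u 1%N / 1%:R), 1%N.
exists (inf A); have infA s : (0 < s)%N -> inf A <= u s / s%:R.
  by move=> s0; apply: ge_inf => //; exists s.
split=> //; last first.
  by move=> c cA; apply: lb_le_inf => // _ [s s0 <-]; apply: cA.
have uM s k : u (k * s)%N <= k%:R * u s + u 0%N.
  elim: k => [|k IH]; first by rewrite mul0r add0r.
  rewrite mulSn (le_trans (uD _ _)) // -natr1 mulrDl mul1r.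
  by apply: (le_trans (lerD (lexx _) IH)); rewrite addrA (addrC (u s)).
apply/cvgrPdist_lt => e e0.
have [_ [s s0 <-] use] := inf_adherent (eps := e / 2) (divr_gt0 e0 (ltr0Sn _ 1)) (conj A0 Alb).
(* [C] bounds the contribution of any remainder modulo s, plus the term [u 0] from [uM]. *)
pose C := \sum_(i < s) u i + u 0%N.
have C0 : 0 <= C by rewrite addr_ge0 ?sumr_ge0.
near=> t.
have t0 : (0 < t)%N by near: t; exists 1%N.
have tR : 0 < t%:R :> R by rewrite ltr0n.
have sR : 0 < s%:R :> R by rewrite ltr0n.
have Ct : C / t%:R < e / 2.
  rewrite ltr_pdivrMr // mulrC -ltr_pdivrMr ?divr_gt0 //.
  by near: t; exact: nbhs_infty_gtr.
have ut : u t <= t%:R * (u s / s%:R) + C.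
  have ts := divn_eq t s; rewrite {1}ts.
  apply: le_trans (uD _ _) _; apply: (le_trans (lerD (uM _ _) (lexx _))).
  rewrite -addrA lerD //.
    rewrite mulrCA mulrC; apply: ler_wpM2l => //.
    by rewrite ler_pdivlMr // -natrM ler_nat leq_divM.
  rewrite addrC /C lerD2r.
  rewrite (bigD1 (Ordinal (ltn_pmod t s0))) //= lerDl.
  by apply: sumr_ge0.
rewrite distrC ger0_norm ?subr_ge0 ?infA //.
have : u t / t%:R <= u s / s%:R + C / t%:R.
  by rewrite ler_pdivrMr // mulrDl divfK ?gt_eqF // mulrC.
move: use Ct; lra.
Unshelve. all: by end_near. Qed.

End Subadditive.

Section Valuations.
Variables (D : idomainType) (w : {fraction D} -> int).
Hypothesis vw : discrete_valuation w.
Local Notation W f := (w (tofrac f)).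
Implicit Types (f g : D) (J : set D).

Lemma tofrac_neq0 f : (tofrac f != 0) = (f != 0).
Proof. by rewrite tofrac_eq0. Qed.

Lemma valM f g : f != 0 -> g != 0 -> W (f * g) = W f + W g.
Proof. by case: vw => wM _ _ f0 g0; rewrite rmorphM wM ?tofrac_neq0. Qed.

Lemma val_ge0 f : f != 0 -> 0 <= W f. Proof. by case: vw => _ _; apply. Qed.

Lemma val1 : w 1 = 0.
Proof.
case: vw => wM _ _; have := wM 1 1 (oner_neq0 _) (oner_neq0 _).
by rewrite mulr1 => /eqP; rewrite -subr_eq0 opprD addNKr oppr_eq0 => /eqP.
Qed.

Lemma valX f k : f != 0 -> W (f ^+ k) = k%:Z * W f.
Proof.
move=> f0; elim: k => [|k IH]; first by rewrite mul0r rmorph1 val1.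
by rewrite exprS valM ?expf_neq0 // IH intS mulrDl mul1r.
Qed.

(** The values on nonzero elements are nonnegative integers, so a least one exists and the default
    of [xget] is not returned. *)
Lemma val_idealP J : (exists2 f, J f & f != 0) ->
  (exists f, [/\ J f, f != 0 & W f = val_ideal w J]) /\
  (forall f, J f -> f != 0 -> val_ideal w J <= W f).
Proof.
move=> [f0 Jf0 f0n0]; rewrite /val_ideal /=; set V := [set w _ | _ in _].
have : exists k, `[< exists f, [/\ J f, f != 0 & W f = k%:Z] >].
  have := val_ge0 f0n0; case E : (W f0) => [k|//] _.
  by exists k; apply/asboolP; exists f0.
move=> /ex_minnP[k /asboolP[f [Jf fn0 fk]] kmin].
have : (V `&` lbound V) (xget 0 (V `&` lbound V)).
  apply: xgetPex; exists k%:Z; split; first by exists f.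
  move=> _ [g [Jg gn0] <-]; have := val_ge0 gn0; case E : (W g) => [l|//] _.
  by rewrite lez_nat kmin //; apply/asboolP; exists g.
by move=> [[g [Jg gn0] gE] lbV]; split=> [|h Jh hn0]; [exists g|apply: lbV; exists h].
Qed.

Variable I : set D.
Hypotheses (iI : is_ideal I) (In0 : exists2 f, I f & f != 0).
Local Notation vI := (val_ideal w I).

Lemma val_ideal_pow m f : ideal_pow I m f -> f != 0 -> m%:Z * vI <= W f.
Proof.
(* The value at 0 is unspecified; admitting 0 separately makes the set closed under sums. *)
suff : ideal_pow I m `<=` [set f | f = 0 \/ m%:Z * vI <= W f].
  by move=> sub /sub[->|//]; rewrite eqxx.
elim: m {f} => [|m IH].
  move=> f _; have [->|f0] := eqVneq f 0; first by left.
  by right; rewrite mul0r val_ge0.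
apply: sumprod_sub => [|x y|a b Ia /IH]; first by left.
  move=> [->|xv]; first by rewrite add0r.
  move=> [->|yv]; first by rewrite addr0; right.
  have [->|x0] := eqVneq x 0; first by rewrite add0r; right.
  have [->|y0] := eqVneq y 0; first by rewrite addr0; right.
  have [->|xy0] := eqVneq (x + y) 0; [by left|right].
  case: vw => _ wD _; have := wD (tofrac x) (tofrac y).
  rewrite -rmorphD !tofrac_neq0 => /(_ x0 y0 xy0); apply: le_trans.
  by rewrite le_min xv yv.
move=> [->|bv]; first by rewrite mulr0; left.
have [->|a0] := eqVneq a 0; first by rewrite mul0r; left.
have [->|b0] := eqVneq b 0; first by rewrite mulr0; left.
right; rewrite valM // intS mulrDl mul1r lerD //.
by have [_ +] := val_idealP In0; apply.
Qed.

(** If [g] has least value in I, then f / g^m is in the valuation ring. *)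
Lemma ext_contr_valuation m f : f = 0 \/ m%:Z * vI <= W f ->
  ext_contr (ideal_pow I m) (valuation_ring w) f.
Proof.
move=> [->|fv]; first by rewrite /ext_contr /= rmorph0; apply: sumprod0.
have [->|f0] := eqVneq f 0; first by rewrite /ext_contr /= rmorph0; apply: sumprod0.
have [[g [Ig g0 gv]] _] := val_idealP In0.
have gm0 : tofrac (g ^+ m) != 0 by rewrite tofrac_neq0 expf_neq0.
rewrite /ext_contr /= -[tofrac f](divfK gm0); apply: sumprod_mem; last first.
  by exists (g ^+ m) => //; apply: ideal_pow1S.
right; case: vw => wM _ _.
have := wM (tofrac f / tofrac (g ^+ m)) (tofrac (g ^+ m)).
rewrite divfK // valX // gv mulf_neq0 ?invr_eq0 ?tofrac_neq0 // ?expf_neq0 //.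
by move=> /(_ isT isT) E; move: fv; rewrite E lerDr.
Qed.

Local Notation a s := (val_ideal w (symbolic_pow I s)).

Lemma symbolic_pow_neq0 s : exists2 f, symbolic_pow I s f & f != 0.
Proof.
have [g Ig g0] := In0; exists (g ^+ s); last exact: expf_neq0.
by apply: sub_symbolic_pow => //; apply: ideal_pow1S.
Qed.

Lemma val_symbolic_ge0 s : 0 <= a s.
Proof.
by have [[f [_ f0 <-]] _] := val_idealP (symbolic_pow_neq0 s); apply: val_ge0.
Qed.

Lemma val_symbolicD s t : a (s + t) <= a s + a t.
Proof.
have [[f [If f0 <-]] _] := val_idealP (symbolic_pow_neq0 s).
have [[g [Ig g0 <-]] _] := val_idealP (symbolic_pow_neq0 t).
have [_ +] := val_idealP (symbolic_pow_neq0 (s + t)).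
by rewrite -valM //; apply; [apply: symbolic_powM|apply: mulf_neq0].
Qed.

Lemma skew_waldschmidtP (R : realType) (what := skew_waldschmidt R w I) :
  [/\ (fun s => (a s)%:~R / s%:R : R) @ \oo --> what,
    forall s, (0 < s)%N -> what <= (a s)%:~R / s%:R &
    forall c, (forall s, (0 < s)%N -> c <= (a s)%:~R / s%:R) -> c <= what].
Proof.
have [||l [cvl lle lge]] := @fekete R (fun s => (a s)%:~R).
- by move=> s; rewrite ler0z val_symbolic_ge0.
- by move=> s t; rewrite -rmorphD ler_int val_symbolicD.
by have -> : what = l by exact: cvg_lim cvl.
Qed.

End Valuations.

(** * Lower and upper bounds for the asymptotic resurgence *)

Section AsymptoticResurgence.
Variables (R : realType) (K : fieldType) (n : nat) (I : set {mpoly K[n]}).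
Hypotheses (iI : is_ideal I) (In0 : exists2 f, I f & f != 0) (hI : homogeneous I).
Implicit Types w : {fraction {mpoly K[n]}} -> int.
Local Notation vI w := (val_ideal w I).
Local Notation a w s := (val_ideal w (symbolic_pow I s)).
Local Notation what w := (skew_waldschmidt R w I).

(** The containment of symbolic powers and subadditivity give s w(I) <= a_((1+mu)s) <= (1+mu) a_s,
    so the constant is at least w(I) / (1+mu). *)
Lemma skew_waldschmidt_gt0 w : discrete_valuation w -> supported w I -> 0 < what w.
Proof.
move=> vw wI; have [mu [g IE]] := ideal_fg iI.
have [_ _ lge] := skew_waldschmidtP vw iI In0 R.
apply: lt_le_trans (lge ((vI w)%:~R / (1 + mu)%:R) _) => [|s s0].
  by rewrite divr_gt0 ?ltr0n ?ltr0z //; apply: lt_le_trans wI.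
have aM k : a w (k.+1 * s) <= k.+1%:Z * a w s.
  elim: k => [|k IH]; first by rewrite !mul1n mul1r.
  rewrite mulSn [_%:Z]intS mulrDl mul1r.
  by apply: le_trans (val_symbolicD vw iI In0 s (k.+1 * s)) _; rewrite lerD2l.
have sv : s%:Z * vI w <= a w ((1 + mu) * s).
  have [[f [If f0 <-]] _] := val_idealP vw (symbolic_pow_neq0 iI In0 ((1 + mu) * s)).
  apply: val_ideal_pow => //; move: If hI; rewrite IE => If hIE.
  exact: (symbolic_sub_ideal_pow hIE s0).
rewrite ler_pdivrMr ?ltr0n // mulrAC ler_pdivlMr ?ltr0n //.
have := le_trans sv (aM mu); rewrite -(ler_int R) !rmorphM /=.
by rewrite mulrC [X in _ <= X]mulrC.
Qed.

Lemma resurgence_witness w s r : discrete_valuation w -> (0 < s)%N ->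
  s%:R * what w < r%:R * (vI w)%:~R ->
  \forall t \near \oo, ~ (symbolic_pow I (s * t) `<=` ideal_pow I (r * t)).
Proof.
move=> vw s0 sr; have [cvw _ _] := skew_waldschmidtP vw iI In0 R.
have sR : 0 < s%:R :> R by rewrite ltr0n.
have : what w < r%:R * (vI w)%:~R / s%:R by rewrite ltr_pdivlMr // mulrC.
move=> /(cvgr_lt _ cvw)[T _ TP]; exists T.+1 => // t /= Tt sub.
have t0 : (0 < t)%N by exact: leq_ltn_trans Tt.
have st : (T <= s * t)%N by rewrite (leq_trans (ltnW Tt)) // leq_pmull.
have := TP _ st; rewrite /= ltr_pdivrMr ?ltr0n ?muln_gt0 ?s0 // natrM mulrA divfK ?gt_eqF //.
have [[f [If f0 <-]] _] := val_idealP vw (symbolic_pow_neq0 iI In0 (s * t)).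
have := val_ideal_pow vw In0 (sub f If) f0.
rewrite -(ler_int R) rmorphM /= => h1 h2; have := le_lt_trans h1 h2.
by rewrite -[(_ * t)%:~R]/((r * t)%:R) natrM mulrAC ltxx.
Qed.

Lemma le_asymptotic_resurgence w : discrete_valuation w -> supported w I ->
  (((vI w)%:~R / what w)%:E <= asymptotic_resurgence R I)%E.
Proof.
move=> vw wI; have w0 := skew_waldschmidt_gt0 vw wI.
have v0 : 0 < (vI w)%:~R :> R by rewrite ltr0z; apply: lt_le_trans wI.
rewrite leNgt; apply/negP => lt.
(* The supremum could a priori be -oo; with y >= 0, a rational above y is positive, hence of the
   form s / r with s and r positive. *)
have [y [y0 yv ylt]] : exists y : R, [/\ 0 <= y, y < (vI w)%:~R / what w &
    (asymptotic_resurgence R I <= y%:E)%E].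
  case: (asymptotic_resurgence R I) lt => [x|//|_]; last first.
    by exists 0; rewrite leNye divr_gt0.
  rewrite lte_fin => xv; exists (Num.max 0 x).
  by rewrite le_max lexx gt_max xv divr_gt0 // lee_fin le_max lexx orbT.
have [q] := rat_in_itvoo yv; rewrite in_itv /= => /andP[yq qv].
have q0 : 0 < q by rewrite -(ltr0q R); apply: le_lt_trans yq.
have nq : 0 < numq q by rewrite numq_gt0.
have := denq_gt0 q; case dq : (denq q) => [r|//] r0.
case sq : (numq q) nq => [s|//] s0.
have qE : ratr q = s%:R / r%:R :> R by rewrite /ratr sq dq.
have : ((s%:R / r%:R)%:E <= asymptotic_resurgence R I)%E.
  apply: ereal_sup_ubound; exists s, r; split=> //.
  apply: (resurgence_witness vw) => //; move: qv; rewrite qE ltr_pdivrMr ?ltr0n //.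
  by rewrite mulrAC ltr_pdivlMr // (mulrC _ r%:R).
by move=> /le_trans/(_ ylt); rewrite lee_fin -qE leNgt yq.
Qed.

Lemma integral_closure_sub mu (g : 'I_mu -> {mpoly K[n]}) N :
  I = ideal_span (range g) ->
  integral_closure (ideal_pow I (N + mu)) `<=` ideal_pow I N.
Proof.
move=> IE f [k [c [k0 cI fk]]]; move: hI cI; rewrite IE => hIE cI.
apply: (integral_ideal_pow hIE k0).
have -> : f ^+ k = - \sum_(1 <= i < k.+1) c i * f ^+ (k - i).
  by apply/eqP; rewrite -subr_eq0 opprK fk.
set X := (X in ideal_span X).
have iX : is_ideal (ideal_span X) by exact: ideal_span_ideal.
apply: is_idealN => //; rewrite big_nat_cond.
apply: is_ideal_sum => // i /andP[ik _].
have /(ideal_pow_pow (ideal_span_ideal _)) := cI i ik.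
rewrite ideal_pow_gen; move: (c i); apply: sumprod_sub => [|x y|b _ _ [e ce <-]].
- by rewrite mul0r; apply: sumprod0.
- by rewrite mulrDl; apply: sumprodD.
rewrite -mulrA; apply: sumprod_mem => //.
(* The pair records the exponent k - i of [f], so that the degree i of [c i] is recovered as k - (k
   - i). *)
exists (e, k - i)%N => //=; rewrite ce subKn; last by case/andP: ik.
by split=> //; move: ik k0; lia.
Qed.

Lemma asymptotic_resurgence_le r (v : 'I_r -> {fraction {mpoly K[n]}} -> int) :
  (forall i, discrete_valuation (v i)) -> represents_closures I v setT ->
  (asymptotic_resurgence R I <=
    \big[Order.max/-oo]_(i < r | `[< supported (v i) I >])
      ((vI (v i))%:~R / what (v i))%:E)%E.
Proof.
move=> vv rep; apply: ge_ereal_sup => _ [s [r' [s0 r0 nearN ->]]].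
rewrite leNgt; apply/negP => /bigmax_ltP[_ sup].
have [mu [g IE]] := ideal_fg iI.
have gap i : supported (v i) I -> 0 < s%:R * what (v i) - r'%:R * (vI (v i))%:~R.
  move=> vi; have := sup i (introT (asboolP _) vi); rewrite lte_fin.
  have w0 := skew_waldschmidt_gt0 (vv i) vi.
  by rewrite ltr_pdivrMr // mulrAC ltr_pdivlMr ?ltr0n // subr_gt0 (mulrC r'%:R).
(* From [bd i] on, t times the gap absorbs the [mu] additional powers demanded by
   [integral_closure_sub]; the sum below exceeds these finitely many bounds. *)
pose bd i := Num.bound (mu%:R * (vI (v i))%:~R /
  (s%:R * what (v i) - r'%:R * (vI (v i))%:~R)).
case: nearN => T _ TP.
pose t := (T + 1 + \sum_i bd i)%N.
apply: (TP t) => [|f If]; first by rewrite /= /t -addnA leq_addr.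
apply: (integral_closure_sub IE).
rewrite rep => i _; apply: ext_contr_valuation => //.
have [->|f0] := eqVneq f 0; [by left|right].
have vI0 : 0 <= vI (v i).
  by have [[h [_ h0 <-]] _] := val_idealP (vv i) In0; apply: val_ge0.
(* For a valuation not supported on I, v(I) = 0 and the bound is trivial. *)
have [vi|] := boolP (1 <= vI (v i)); last first.
  rewrite -ltNge => vi; have -> : vI (v i) = 0 by lia.
  by rewrite mulr0 val_ge0.
have [_ lle _] := skew_waldschmidtP (vv i) iI In0 R.
have [_ /(_ f If f0)] := val_idealP (vv i) (symbolic_pow_neq0 iI In0 (s * t)).
apply: le_trans; rewrite -(ler_int R).
have t0 : (0 < t)%N by rewrite /t addn1 addSn.
have := lle (s * t)%N; rewrite muln_gt0 s0 t0 => /(_ isT).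
rewrite ler_pdivlMr ?ltr0n ?muln_gt0 ?s0 //; apply: le_trans.
rewrite rmorphM /= -[(_ + mu)%:~R]/((r' * t + mu)%:R) natrD !natrM.
have bdt : mu%:R * (vI (v i))%:~R <=
    t%:R * (s%:R * what (v i) - r'%:R * (vI (v i))%:~R).
  rewrite -ler_pdivrMr ?gap //.
  apply: le_trans (ltW (archi_boundP _)) _.
    by rewrite divr_ge0 ?mulr_ge0 ?ler0n ?ler0z // ltW ?gap.
  by rewrite ler_nat /t (bigD1 i) //= -/(bd i); lia.
by move: bdt; lra.
Qed.

End AsymptoticResurgence.

Theorem theorem4p10 (R : realType) (K : fieldType) (n : nat)
    (I : set {mpoly K[n]})
    (I_proper_ideal : idealr_closed (mem I))
    (I_neq0 : exists2 f, I f & f != 0)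
    (I_homogeneous : homogeneous I)
    (r : nat) (v : 'I_r -> {fraction {mpoly K[n]}} -> int)
    (v_rees : rees_valuations I v) :
  asymptotic_resurgence R I =
    \big[Order.max/-oo%E]_(i < r | `[< supported (v i) I >])
      ((val_ideal (v i) I)%:~R / skew_waldschmidt R (v i) I)%:E
  /\
  asymptotic_resurgence R I =
    ereal_sup [set ((val_ideal w I)%:~R / skew_waldschmidt R w I)%:E
              | w in [set w | discrete_valuation w /\ supported w I]].
Proof.
have iI : is_ideal I.
  have [I0 _ IM] := I_proper_ideal; split; first exact: set_mem I0.
    by move=> x y Ix Iy; rewrite -[x]mul1r; apply/set_mem/IM; apply/mem_set.
  move=> a x Ix; rewrite -[a * x]addr0.
  by apply/set_mem/IM; [apply/mem_set|exact: I0].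
have [v_val v_rep _] := v_rees.
have {}v_val i : discrete_valuation (v i) by have [] := v_val i.
set rho := asymptotic_resurgence R I; set M := \big[_/_]_(_ | _) _; set C := ereal_sup _.
have rhoM : (rho <= M)%E by exact: asymptotic_resurgence_le.
have MC : (M <= C)%E.
  apply/bigmax_leP; split=> [|i /asboolP vi]; first exact: leNye.
  by apply: ereal_sup_ubound; exists (v i).
have Crho : (C <= rho)%E.
  by apply: ge_ereal_sup => _ [w [vw wI] <-]; apply: le_asymptotic_resurgence.
by split; apply/eqP; rewrite eq_le ?rhoM ?(le_trans MC) ?(le_trans rhoM).
Qed.
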